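(* Let $F \in \mathbb{R}[x_1, \ldots, x_n]$ be a homogeneous form of degree $d > 1$ satisfying $n - \dim V_F^* > 4$. Let $\theta_j \le \theta_j'$ $(1 \le j \le n)$ be real numbers. Suppose $\mathbf{x}_0 \in (0,1)^n$ satisfies $F(\mathbf{x}_0) = 0$ and is non-singular, i.e. $\nabla F(\mathbf{x}_0) \neq \mathbf{0}$. Let $\varpi : \mathbb{R}^n \to \mathbb{R}$ be a smooth function whose support is contained in $\mathbf{x}_0 + [-\delta_0, \delta_0]^n$ for some $\delta_0 > 0$. Then, provided $\delta_0$ is sufficiently small, there is a constant $C > 0$ (which may depend on $F$, $\mathbf{x}_0$, $\varpi$, $\delta_0$ and the $\theta_j, \theta_j'$) such that for all $\tau \in \mathbb{R}$, all $\mathbf{r} = (r_1, \ldots, r_n) \in [\theta_1, \theta_1'] \times \cdots \times [\theta_n, \theta_n']$ and all $\mathbf{t} = (t_1, \ldots, t_n) \in \mathbb{R}^n$, $$\Big| \int_0^\infty \cdots \int_0^\infty \varpi(\mathbf{x})\, x_1^{r_1 + i t_1} \cdots x_n^{r_n + i t_n}\, e^{2\pi i \tau F(\mathbf{x})}\, d\mathbf{x} \Big| \le C \min\{1, |\tau|^{-1}\},$$ where $\min\{1,|\tau|^{-1}\}$ is interpreted as $1$ when $\tau = 0$. In particular $C$ is independent of $\tau$, $\mathbf{r}$ and $\mathbf{t}$.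
   Context: $V_F^* = \{\mathbf{z} \in \mathbb{C}^n : \nabla F(\mathbf{z}) = \mathbf{0}\}$ is the singular locus of $V(F) = \{\mathbf{z} \in \mathbb{C}^n : F(\mathbf{z}) = 0\}$, regarded as an affine variety in $\mathbb{A}^n_{\mathbb{C}}$, and $\dim V_F^*$ is its dimension. For $x > 0$ and $s \in \mathbb{C}$, $x^{s} = e^{s \log x}$. *)

(* Defs.v *)
From HB Require Import structures.
From mathcomp Require Import all_boot all_order all_algebra.
(* mpoly must be Imported before the analysis libraries: in the other order
   their notations clash. *)
From mathcomp Require Import mpoly.
From mathcomp Require Import complex.
From mathcomp Require Import all_classical all_reals all_analysis.

Set Implicit Arguments.
Unset Strict Implicit.
Unset Printing Implicit Defensive.

Import Order.TTheory GRing.Theory Num.Theory.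
Import numFieldNormedType.Exports.

Local Open Scope classical_set_scope.
Local Open Scope ring_scope.
Local Open Scope complex_scope.

Section AffineDimension.
Context {R : realType} {n : nat}.
Local Notation C := R[i].
Implicit Types (V Z : set 'rV[C]_n).

Definition zero_locus (S : set {mpoly C[n]}) : set 'rV[C]_n :=
  [set z | forall p, S p -> p.@[z ord0] = 0].

Definition zariski_closed Z := exists S, Z = zero_locus S.

Definition irreducible_closed Z :=
  [/\ zariski_closed Z, Z !=set0 &
      forall A B, zariski_closed A -> zariski_closed B ->
        Z = A `|` B -> Z = A \/ Z = B].

Definition irreducible_chain V (k : nat) (W : nat -> set 'rV[C]_n) :=
  (forall i, (i <= k)%N -> irreducible_closed (W i) /\ W i `<=` V) /\
  (forall i, (i < k)%N -> W i `<` W i.+1).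

(* Krull dimension of a closed V; -oo when V is empty *)
Definition affine_dim V : \bar R :=
  ereal_sup [set (k%:R)%:E | k in [set k | exists W, irreducible_chain V k W]].

Definition singular_locus (F : {mpoly R[n]}) : set 'rV[C]_n :=
  [set z | forall i, (map_mpoly (real_complex R) F)^`M(i).@[z ord0] = 0].

End AffineDimension.

Section Smooth.
Context {R : realType} {n : nat}.

Definition partial (j : 'I_n) (f : 'rV[R]_n -> R) : 'rV[R]_n -> R :=
  fun x => 'D_(delta_mx ord0 j) f x.

Definition iter_partial (s : seq 'I_n) (f : 'rV[R]_n -> R) : 'rV[R]_n -> R :=
  foldr partial f s.

Definition smooth (f : 'rV[R]_n -> R) :=
  forall s : seq 'I_n,
    continuous (iter_partial s f) /\
    forall (j : 'I_n) x, derivable (iter_partial s f) x (delta_mx ord0 j).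

Definition fsupport (f : 'rV[R]_n -> R) : set 'rV[R]_n :=
  closure [set x | f x != 0].

Definition cube (x0 : 'rV[R]_n) (delta : R) : set 'rV[R]_n :=
  [set x | forall j, `|x ord0 j - x0 ord0 j| <= delta].

End Smooth.

Section ComplexIntegral.
Context {R : realType}.
Local Notation C := R[i].

Definition cexp (z : C) : C :=
  (expR (complex.Re z))%:C * (cos (complex.Im z) +i* sin (complex.Im z)).

(* meaningful for x > 0 only *)
Definition cpow (x : R) (s : C) : C := cexp (s * (ln x)%:C).

(* The iterated integral over x_1, ..., x_n in ]0, +oo[; x_1 is outermost. *)
Fixpoint iter_integral (n : nat) : ('rV[R]_n -> R) -> R :=
  match n with
  | 0 => fun f => f 0
  | m.+1 => fun f =>
      \int[lebesgue_measure]_(x in `]0%R, +oo[)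
        iter_integral (fun v : 'rV[R]_m => f (row_mx (x%:M : 'rV_1) v))
  end.

Definition iter_cintegral (n : nat) (f : 'rV[R]_n -> C) : C :=
  iter_integral (fun x => complex.Re (f x)) +i*
  iter_integral (fun x => complex.Im (f x)).

Definition oscillatory_integrand (n : nat) (F : {mpoly R[n]})
    (varpi : 'rV[R]_n -> R) (tau : R) (r t : 'I_n -> R) (x : 'rV[R]_n) : C :=
  (varpi x)%:C * (\prod_(j < n) cpow (x ord0 j) (r j +i* t j)) *
  cexp ((2 * pi * tau * F.@[x ord0])%:C * 'i).

(* min {1, |tau|^-1}, equal to 1 at tau = 0 (where tau^-1 is 0 here) *)
Definition min1inv (tau : R) : R :=
  if tau == 0 then 1 else Num.min 1 `|tau|^-1.

End ComplexIntegral.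

(* Main.v *)
Require Import Defs.
From HB Require Import structures.
From mathcomp Require Import all_boot all_order all_algebra.
From mathcomp Require Import mpoly.
From mathcomp Require Import complex.
From mathcomp Require Import all_classical all_reals all_analysis.
From mathcomp Require Import ring lra.

(* Write [f = 2 pi F] and let [tau f + sum_k t_k ln x_k] be the phase.
   Differentiating along [x_k d/dx_k] removes the [t_k] from all derivatives of
   the phase but the first, which makes the estimates uniform in [t].  Put
   [s = (1 + |tau|)^(-1/2)], let [q_k = s (tau x_k d_k f + t_k)] be the rescaled
   logarithmic gradient and [L = 1 / (1 + sum_k q_k ^ 2)].  Integrating by parts
   along [s L sum_k q_k x_k d/dx_k] replaces the amplitude by amplitudes smaller
   by a factor [O(L + s ^ 2)]; after two steps the integral is bounded by a
   multiple of [s ^ 2] plus the integral of [L ^ 2].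

   Near [x0] the logarithmic Hessian of [f] has a nonzero two by two minor: by
   Euler's identity this follows from [F(x0) = 0] and [grad F(x0) <> 0].  Hence,
   when all coordinates but two suitable ones are frozen, [|q|] grows at least
   linearly, at rate [s |tau|], in the distance to a point where it is minimal;
   then [L ^ 2] is at most a product of two Lorentzians of width [1 / (s |tau|)],
   and its integral is [O(1 / (s tau) ^ 2)], that is [O(s ^ 2)] for
   [|tau| >= 1].

   An iterated integral of a continuous function vanishing off the open unit
   cube is a limit of midpoint Riemann sums, whose coordinates may be summed in
   any order. *)

Set Implicit Arguments.
Unset Strict Implicit.
Unset Printing Implicit Defensive.

Import Order.TTheory GRing.Theory Num.Theory.
Import numFieldNormedType.Exports.

Local Open Scope classical_set_scope.
Local Open Scope ring_scope.
Local Open Scope complex_scope.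

(** * Midpoint Riemann sums *)

Section MidpointRule.
Context {R : realType}.
Implicit Types (f g : R -> R) (e : R) (N : nat).
Local Notation mu := (@lebesgue_measure R).

Definition midpoint (N a : nat) : R := (a%:R + 2^-1) / N.+1%:R.

Definition midpoint_mean (N : nat) (g : R -> R) : R :=
  N.+1%:R^-1 * \sum_(a < N.+1) g (midpoint N a).

Lemma midpoint_itv N a : (a < N.+1)%N -> 0 < midpoint N a < 1.
Proof.
move=> aN; rewrite /midpoint divr_gt0 ?ltr0Sn ?addr_ge0 ?ltr_pwDr ?invr_gt0//=.
rewrite ltr_pdivrMr ?ltr0Sn// mul1r.
rewrite (@lt_le_trans _ _ (a.+1%:R))//; last by rewrite ler_nat.
by rewrite -[a.+1]addn1 natrD; lra.
Qed.

Lemma dist_midpoint N a (c : R) : a%:R / N.+1%:R <= c <= a.+1%:R / N.+1%:R ->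
  `|c - midpoint N a| <= N.+1%:R^-1.
Proof.
have Np : 0 < N.+1%:R^-1 :> R by rewrite invr_gt0 ltr0Sn.
rewrite /midpoint -[a.+1]addn1 natrD !mulrDl mul1r.
set u := N.+1%:R^-1 in Np *; set b := a%:R * u => /andP[? ?].
by rewrite ler_norml; apply/andP; split; lra.
Qed.

Lemma ler_norm_average N (F : 'I_N.+1 -> R) e :
  (forall a, `|F a| <= e) -> `|N.+1%:R^-1 * \sum_(a < N.+1) F a| <= e.
Proof.
move=> Fe; rewrite normrM ger0_norm ?invr_ge0// ler_pdivrMl ?ltr0Sn//.
apply: (le_trans (ler_norm_sum _ _ _)).
apply: (le_trans (ler_sum _ (fun i _ => Fe i))).
by rewrite sumr_const card_ord mulr_natl.
Qed.

Lemma midpoint_meanD N f g :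
  midpoint_mean N (fun a => f a + g a) = midpoint_mean N f + midpoint_mean N g.
Proof. by rewrite /midpoint_mean big_split mulrDr. Qed.

Lemma midpoint_meanZ N c f :
  midpoint_mean N (fun a => c * f a) = c * midpoint_mean N f.
Proof. by rewrite /midpoint_mean -mulr_sumr mulrCA. Qed.

Lemma midpoint_meanB N f g :
  midpoint_mean N (fun a => f a - g a) = midpoint_mean N f - midpoint_mean N g.
Proof. by rewrite /midpoint_mean sumrB mulrBr. Qed.

Lemma midpoint_mean_cst N c : midpoint_mean N (fun=> c) = c.
Proof.
by rewrite /midpoint_mean sumr_const card_ord -[c *+ _]mulr_natl mulKf ?pnatr_eq0.
Qed.

Lemma exchange_midpoint_mean N (h : R -> R -> R) :
  midpoint_mean N (fun a => midpoint_mean N (h a)) =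
  midpoint_mean N (fun b => midpoint_mean N (fun a => h a b)).
Proof.
by rewrite /midpoint_mean -!mulr_sumr exchange_big.
Qed.

Lemma ler_midpoint_mean N f g : (forall a, 0 < a < 1 -> f a <= g a) ->
  midpoint_mean N f <= midpoint_mean N g.
Proof.
move=> fg; rewrite ler_wpM2l ?invr_ge0// ler_sum// => a _.
exact/fg/midpoint_itv.
Qed.

Lemma eq_midpoint_mean N f g : (forall a, 0 < a < 1 -> f a = g a) ->
  midpoint_mean N f = midpoint_mean N g.
Proof.
by move=> fg; apply/le_anti/andP; split; apply: ler_midpoint_mean => a /fg ->.
Qed.

Lemma ler_norm_midpoint_mean N g e : (forall a, 0 < a < 1 -> `|g a| <= e) ->
  `|midpoint_mean N g| <= e.
Proof. by move=> ge; apply: ler_norm_average => a; apply/ge/midpoint_itv. Qed.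

Lemma antiderivative_midpoint_error N (G g : R -> R) e :
  {within `[0, 1], continuous G} ->
  (forall x : R, 0 < x < 1 -> is_derive x (1 : R) G (g x)) ->
  (forall x y : R, `|x - y| <= N.+1%:R^-1 -> `|g x - g y| <= e) ->
  `|(G 1 - G 0) - midpoint_mean N g| <= e.
Proof.
move=> Gc Gd ge; have N0 : N.+1%:R != 0 :> R by rewrite pnatr_eq0.
have Np : 0 < N.+1%:R^-1 :> R by rewrite invr_gt0 ltr0Sn.
have -> : G 1 - G 0 =
    \sum_(a < N.+1) (G (a.+1%:R / N.+1%:R) - G (a%:R / N.+1%:R)).
  rewrite -(big_mkord xpredT (fun a => G (a.+1%:R / N.+1%:R) - G (a%:R / N.+1%:R))).
  by rewrite telescope_sumr// divff ?mul0r.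
rewrite -[X in X - _](mulKf N0) -mulrBr mulr_sumr -sumrB.
apply: ler_norm_average => a.
have lo : 0 <= a%:R / N.+1%:R :> R by rewrite mulr_ge0.
have hi : a.+1%:R / N.+1%:R <= 1 :> R.
  by rewrite ler_pdivrMr ?ltr0Sn// mul1r ler_nat.
have cell : a%:R / N.+1%:R < a.+1%:R / N.+1%:R :> R by rewrite ltr_pM2r// ltr_nat.
have [||c] := @MVT R G g _ _ cell.
- move=> x; rewrite in_itv/= => /andP[x1 x2]; apply: Gd.
  by rewrite (le_lt_trans lo)//= (lt_le_trans x2).
- apply: continuous_subspaceW Gc => x /=; rewrite !in_itv/=.
  by move=> /andP[/(le_trans lo) -> /le_trans ->].
rewrite in_itv/= => /andP[c1 c2] ->.
have -> : N.+1%:R * (g c * (a.+1%:R / N.+1%:R - a%:R / N.+1%:R)) = g c.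
  by rewrite -mulrBl -natrB// subSnn mul1r mulrCA mulfV ?mulr1.
by apply/ge/dist_midpoint; rewrite !ltW.
Qed.

Lemma Rintegral_midpoint_error (g : R -> R) N e : continuous g ->
  (forall x : R, ~~ (0 < x < 1) -> g x = 0) ->
  (forall x y : R, `|x - y| <= N.+1%:R^-1 -> `|g x - g y| <= e) ->
  `|\int[mu]_(x in `]0%R, +oo[) g x - midpoint_mean N g| <= e.
Proof.
move=> gc g0 ge.
have gi a b : mu.-integrable `[a, b] (EFin \o g).
  apply: continuous_compact_integrable; first exact: segment_compact.
  exact: continuous_subspaceT.
pose G (x : R) := \int[mu]_(t in `[(-1)%R, x]) g t.
have Gd (x : R) : -1 < x < 3 -> is_derive x (1 : R) G (g x).
  move=> /andP[x1 x3].
  have [d1 d2] := continuous_FTC1_closed x3 (gi _ _) x1 (gc x).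
  by apply: (DeriveDef d1); rewrite -derive1E.
have -> : \int[mu]_(x in `]0%R, +oo[) g x = G 1 - G 0.
  rewrite /G Rintegral_itvB ?bnd_simp ?lerN10//=.
  rewrite Rintegral_mkcond [RHS]Rintegral_mkcond; congr Rintegral.
  apply/funext => x; rewrite /patch !mem_setE !in_itv/= andbT.
  have := g0 x; case: (ltP 0 x) => //= x0; case: (leP x 1) => //= x1.
  by apply; rewrite -leNgt ltW.
apply: antiderivative_midpoint_error => // [|x x01]; last by apply: Gd; lra.
apply: continuous_in_subspaceT => x; rewrite inE/= in_itv/= => x01.
apply: differentiable_continuous; apply/derivable1_diffP.
by have /Gd[] : -1 < x < 3 by lra.
Qed.

Lemma near_invS_le (h : R) : 0 < h -> \forall N \near \oo, N.+1%:R^-1 <= h.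
Proof.
move=> h0; have := near_infty_natSinv_lt (PosNum h0).
by apply: filterS => N /ltW.
Qed.

End MidpointRule.

Section Lorentzians.
Context {R : realType}.
Implicit Types (a c h s : R) (N : nat).

Definition lorentzian a : R := (1 + a ^+ 2)^-1.

Lemma lorentzian_ge0 a : 0 <= lorentzian a.
Proof. by rewrite invr_ge0 addr_ge0 ?sqr_ge0. Qed.

Lemma lorentzian_le_atan a h : 0 <= h <= 1 ->
  h * lorentzian a <= 3 * (atan (a + h) - atan a).
Proof.
move=> /andP[h0 h1]; have aah : a <= a + h by rewrite lerDl.
have atan_der (x : R) : x \in `]a, a + h[ -> is_derive x (1 : R) atan (lorentzian x).
  by move=> _; exact: is_derive1_atan.
have [|z] := MVT_segment aah atan_der.
  by apply: continuous_subspaceT => x; exact: continuous_atan.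
rewrite in_itv/= => /andP[az zah] ->.
rewrite addrAC subrr add0r mulrA [leRHS]mulrC ler_wpM2l// /lorentzian.
rewrite ler_pdivlMr ?ltr_pwDl ?sqr_ge0// mulrC ler_pdivrMr ?ltr_pwDl ?sqr_ge0//.
have za1 : (z - a) ^+ 2 <= 1 by rewrite expr_le1// ?subr_ge0//; lra.
by have := sqr_ge0 (2 * a - z); have := sqr_ge0 a; lra.
Qed.

Lemma midpoint_mean_lorentzian_le s c N : 0 < s <= N.+1%:R ->
  midpoint_mean N (fun a => lorentzian (s * (a - c))) <= 3 * pi / s.
Proof.
move=> /andP[s0 sN]; have N0 : 0 < N.+1%:R :> R by rewrite ltr0Sn.
pose t (a : nat) : R := s * (midpoint N a - c); pose h := s / N.+1%:R.
have h01 : 0 <= h <= 1.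
  by apply/andP; split; [rewrite divr_ge0// ltW|rewrite ler_pdivrMr// mul1r].
have tS (a : nat) : t a.+1 = t a + h.
  by rewrite /t /h /midpoint -[a.+1]addn1 natrD; field; rewrite gt_eqF.
rewrite ler_pdivlMr// mulrC /midpoint_mean mulrA -/h mulr_sumr.
apply: (@le_trans _ _ (3 * (atan (t N.+1) - atan (t 0)))).
  rewrite -(telescope_sumr (fun a : nat => atan (t a)) (leq0n N.+1)).
  rewrite big_mkord mulr_sumr.
  by apply: ler_sum => a _; rewrite tS; exact: lorentzian_le_atan.
by rewrite ler_pM2l//; have := atan_ltpi2 (t N.+1); have := atan_gtNpi2 (t 0); lra.
Qed.

Lemma midpoint_mean2_lorentzian_le (g : R -> R -> R) s c d N : 0 < s <= N.+1%:R ->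
  (forall a b, g a b <= lorentzian (s * (a - c)) * lorentzian (s * (b - d))) ->
  midpoint_mean N (fun a => midpoint_mean N (g a)) <= (3 * pi / s) ^+ 2.
Proof.
move=> sN gle.
have mean_ge0 b : 0 <= midpoint_mean N (fun a => lorentzian (s * (a - b))).
  by rewrite mulr_ge0 ?invr_ge0// sumr_ge0// => a _; exact: lorentzian_ge0.
apply: (@le_trans _ _ (midpoint_mean N (fun a => lorentzian (s * (a - c))) *
    midpoint_mean N (fun b => lorentzian (s * (b - d))))).
  rewrite mulrC -midpoint_meanZ; apply: ler_midpoint_mean => a _.
  by rewrite mulrC -midpoint_meanZ; apply: ler_midpoint_mean => b _; exact: gle.
by rewrite expr2 ler_pM// midpoint_mean_lorentzian_le.
Qed.

End Lorentzians.

Section RowVectors.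
Context {R : realType} {n : nat}.
Implicit Types (x v w : 'rV[R]_n) (a b h : R) (k : 'I_n).

Definition row_cons a v : 'rV[R]_n.+1 := row_mx (a%:M : 'rV_1) v.

Definition set_coord x k a : 'rV[R]_n :=
  \row_l (if l == k then a else x ord0 l).

Definition unit_cube : set 'rV[R]_n := [set x | forall k, 0 < x ord0 k < 1].

Lemma row_cons0 a v : row_cons a v ord0 ord0 = a.
Proof.
rewrite /row_cons; have -> : ord0 = lshift n (ord0 : 'I_1) by exact: val_inj.
by rewrite (row_mxEl (a%:M : 'rV_1) v) mxE.
Qed.

Lemma row_consS a v k : row_cons a v ord0 (lift ord0 k) = v ord0 k.
Proof.
rewrite /row_cons; have -> : lift ord0 k = rshift 1 k by exact: val_inj.
by rewrite (row_mxEr (a%:M : 'rV_1) v).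
Qed.

Lemma cube_row_cons h a b v w : `|a - b| <= h -> cube w h v ->
  cube (row_cons b w) h (row_cons a v).
Proof.
by move=> ab vw l; have [k ->|->] := unliftP ord0 l; rewrite ?row_cons0 ?row_consS.
Qed.

Lemma set_coordE x k a : set_coord x k a ord0 k = a.
Proof. by rewrite mxE eqxx. Qed.

Lemma set_coord_line x k a : set_coord x k a = set_coord x k 0 + a *: delta_mx ord0 k.
Proof.
apply/rowP => l; rewrite !mxE eqxx /=.
by case: eqP => _; rewrite ?mulr1 ?mulr0 (add0r, addr0).
Qed.

Lemma unit_cube_set_coord x k a : unit_cube x -> 0 < a < 1 ->
  unit_cube (set_coord x k a).
Proof. by move=> xu a01 l; rewrite mxE; case: eqP. Qed.

Lemma cube_set_coord x k a b h : `|a - b| <= h ->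
  cube (set_coord x k b) h (set_coord x k a).
Proof.
move=> ab l; rewrite !mxE; case: eqP => // _.
by rewrite subrr normr0 (le_trans _ ab).
Qed.

Lemma cubeS x h h' : h <= h' -> cube x h `<=` cube x h'.
Proof. by move=> hh' y xy k; exact: le_trans (xy k) hh'. Qed.

Lemma compact_cube x h : compact (cube x h).
Proof.
pose A i := `[x ord0 i - h, x ord0 i + h]%classic.
rewrite (_ : cube x h = [set v : 'rV[R]_n | forall i, A i (v ord0 i)]).
  by apply: rV_compact => i; exact: segment_compact.
by apply/seteqP; split=> v /= + i => /(_ i); rewrite /A/= in_itv/= ler_distl.
Qed.

Lemma unit_cube_sub_cube : unit_cube `<=` cube (\row__ 2^-1) 2^-1.
Proof.
move=> x xu k; rewrite mxE ler_norml; have /andP[? ?] := xu k.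
by apply/andP; split; lra.
Qed.

Lemma unit_cube_neq0 x k : unit_cube x -> x ord0 k != 0.
Proof. by move=> /(_ k)/andP[/gt_eqF ->]. Qed.

End RowVectors.

Lemma unit_cube_row_cons (R : realType) n (a : R) (v : 'rV[R]_n) :
  unit_cube (row_cons a v) <-> 0 < a < 1 /\ unit_cube v.
Proof.
split=> [u|[a01 vu] l].
  split=> [|k]; [have := u ord0|have := u (lift ord0 k)];
    by rewrite ?row_cons0 ?row_consS.
by have [k ->|->] := unliftP ord0 l; rewrite ?row_cons0 ?row_consS.
Qed.

Lemma set_coord_row_cons0 (R : realType) n (a b : R) (v : 'rV[R]_n) :
  set_coord (row_cons a v) ord0 b = row_cons b v.
Proof.
apply/rowP => l; rewrite mxE.
by have [k ->|->] := unliftP ord0 l; rewrite ?row_consS ?row_cons0.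
Qed.

Lemma set_coord_row_consS (R : realType) n (a b : R) (v : 'rV[R]_n) k :
  set_coord (row_cons a v) (lift ord0 k) b = row_cons a (set_coord v k b).
Proof.
apply/rowP => l; rewrite mxE.
have [i ->|->] := unliftP ord0 l; last by rewrite !row_cons0.
by rewrite !row_consS mxE (inj_eq lift_inj).
Qed.

Lemma unif_continuous_cst_outside_compact (R : realType) (T U : pseudoMetricType R)
    (f : T -> U) (K : set T) (c : U) :
  compact K -> continuous f -> (forall x, ~ K x -> f x = c) -> unif_continuous f.
Proof.
move=> cK cf fc; apply/unif_continuousP => e e0.
pose P (h : R) x := forall y, ball x h y -> ball (f x) e (f y).
have locally_P x : K x -> \forall x' \near x & h \near (0 : R)^'+, P h x'.
  move=> _; have /cvg_ballP/(_ (e / 2)) := cf x.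
  rewrite divr_gt0// => /(_ isT)/nbhs_ballP[r /= r0 fr].
  have r2 : 0 < r / 2 by rewrite divr_gt0.
  exists (ball x (r / 2), [set h : R | h < r / 2]) => /=.
    by split; [exact: nbhsx_ballx|exact: nbhs_right_lt].
  move=> -[x' h] /= [xx' hr] y x'y; apply: (ball_splitr (z := f x)).
    by apply: fr; apply: le_ball xx'; rewrite ler_pdivrMr// ler_peMr ?ler1n// ltW.
  by apply: fr; apply: (ball_split xx'); apply: le_ball x'y; exact: ltW.
have /compact_near_coveringP/(_ R (0 : R)^'+ P _ locally_P) nearK := cK.
have [h [KP h0]] : exists h : R, K `<=` P h /\ 0 < h.
  apply: (@filter_ex _ (0 : R)^'+); apply: filterI; [exact: nearK|exact: nbhs_right_gt].
exists h => // -[x y] /= xy.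
have [Kx|nKx] := pselect (K x); first exact: KP.
have [Ky|nKy] := pselect (K y); first by apply/ball_sym/KP => //; exact/ball_sym.
by rewrite !fc//; exact: ballxx.
Qed.

Section RiemannSums.
Context {R : realType}.
Implicit Types (N n : nat) (e : R).

Fixpoint riemann_sum N n : ('rV[R]_n -> R) -> R :=
  match n with
  | 0 => fun f => f 0
  | m.+1 => fun f =>
      midpoint_mean N (fun a => riemann_sum N (fun v : 'rV_m => f (row_cons a v)))
  end.

Lemma ler_riemann_sum N n (f g : 'rV[R]_n -> R) :
  (forall x, unit_cube x -> f x <= g x) -> riemann_sum N f <= riemann_sum N g.
Proof.
elim: n f g => [|n IH] f g fg /=; first by apply: fg => -[].
apply: ler_midpoint_mean => a a01; apply: IH => v vu.
by apply: fg; exact/unit_cube_row_cons.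
Qed.

Lemma eq_riemann_sum N n (f g : 'rV[R]_n -> R) :
  (forall x, unit_cube x -> f x = g x) -> riemann_sum N f = riemann_sum N g.
Proof.
by move=> fg; apply/le_anti/andP; split; apply: ler_riemann_sum => x /fg ->.
Qed.

Lemma ler_norm_riemann_sum N n (f : 'rV[R]_n -> R) e :
  (forall x, unit_cube x -> `|f x| <= e) -> `|riemann_sum N f| <= e.
Proof.
elim: n f => [|n IH] f fe /=; first by apply: fe => -[].
apply: ler_norm_midpoint_mean => a a01; apply: IH => v vu.
by apply: fe; exact/unit_cube_row_cons.
Qed.

Lemma riemann_sum_cst N n (c : R) : riemann_sum N (fun _ : 'rV[R]_n => c) = c.
Proof.
elim: n => [//|n IH] /=; rewrite -[RHS](midpoint_mean_cst N).
by apply: eq_midpoint_mean => a _; exact: IH.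
Qed.

Lemma riemann_sumD N n (f g : 'rV[R]_n -> R) :
  riemann_sum N (fun x => f x + g x) = riemann_sum N f + riemann_sum N g.
Proof.
elim: n f g => [|n IH] f g //=; rewrite -midpoint_meanD.
by apply: eq_midpoint_mean => a _; exact: IH.
Qed.

Lemma riemann_sumZ N n (c : R) (f : 'rV[R]_n -> R) :
  riemann_sum N (fun x => c * f x) = c * riemann_sum N f.
Proof.
elim: n f => [|n IH] f //=; rewrite -midpoint_meanZ.
by apply: eq_midpoint_mean => a _; exact: IH.
Qed.

Lemma riemann_sum_midpoint_mean N n (h : R -> 'rV[R]_n -> R) :
  riemann_sum N (fun x => midpoint_mean N (h^~ x)) =
  midpoint_mean N (fun b => riemann_sum N (h b)).
Proof.
elim: n h => [|n IH] h //=; rewrite exchange_midpoint_mean.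
by apply: eq_midpoint_mean => a _; exact: IH.
Qed.

Lemma riemann_sum_coord_mean N n (k : 'I_n) (f : 'rV[R]_n -> R) :
  riemann_sum N (fun x => midpoint_mean N (fun a => f (set_coord x k a))) =
  riemann_sum N f.
Proof.
elim: n k f => [[]//|n IH] k f /=.
have [k' ->|->] := unliftP ord0 k.
  apply: eq_midpoint_mean => a _; rewrite -[RHS](IH k'); apply: eq_riemann_sum => v _.
  by apply: eq_midpoint_mean => b _; rewrite set_coord_row_consS.
rewrite -[RHS](midpoint_mean_cst N) /=; apply: eq_midpoint_mean => a _.
rewrite riemann_sum_midpoint_mean; apply: eq_midpoint_mean => b _.
by apply: eq_riemann_sum => v _; rewrite set_coord_row_cons0.
Qed.

End RiemannSums.

Section TestFunctions.
Context {R : realType} {n : nat}.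
Implicit Types (f g : 'rV[R]_n -> R) (x : 'rV[R]_n) (e : R).

Definition test_function f :=
  continuous f /\ forall x, ~ unit_cube x -> f x = 0.

Lemma test_functionD f g : test_function f -> test_function g ->
  test_function (fun x => f x + g x).
Proof.
move=> [fc f0] [gc g0]; split=> [x|x xu]; last by rewrite f0// g0// addr0.
exact: (cvgD (fc x) (gc x)).
Qed.

Lemma test_functionZ (c : R) f : test_function f -> test_function (fun x => c * f x).
Proof.
move=> [fc f0]; split=> [x|x xu]; last by rewrite f0// mulr0.
exact: (cvgM (@cst_continuous _ _ c x) (fc x)).
Qed.

Lemma test_function0 : test_function (fun=> 0).
Proof. by split=> // x; exact: cst_continuous. Qed.

Lemma test_function_sum I (s : seq I) (F : I -> 'rV[R]_n -> R) :
  (forall i, test_function (F i)) -> test_function (fun x => \sum_(i <- s) F i x).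
Proof.
move=> tF; elim: s => [|i s IH].
  by under eq_fun do rewrite big_nil; exact: test_function0.
by under eq_fun do rewrite big_cons; exact: test_functionD.
Qed.

Lemma cube_modulus_continuous f :
  (forall e, 0 < e -> exists2 h, 0 < h & forall x y, cube y h x -> `|f x - f y| <= e) ->
  continuous f.
Proof.
move=> fm x; apply/(@cvgrPdist_le _ _ _ _ (nbhs_filter x)) => e /fm[h h0 fh].
apply/nbhs_ballP; exists h => // y [_ xy]; apply: fh => k; apply: ltW; exact: xy.
Qed.

Lemma test_function_modulus f e : test_function f -> 0 < e ->
  exists2 h, 0 < h & forall x y, cube y h x -> `|f x - f y| <= e.
Proof.
move=> [fc f0] e0; have f_out x : ~ cube (\row__ 2^-1) 2^-1 x -> f x = 0.
  by move=> xK; apply: f0 => /unit_cube_sub_cube.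
have fu := unif_continuous_cst_outside_compact (@compact_cube _ _ _ _) fc f_out.
have /unif_continuousP/(_ e e0)[d d0 fd] := fu.
exists (d / 2); first by rewrite divr_gt0.
move=> x y xy; apply/ltW/(fd (x, y)); split=> // i k; rewrite (ord1 i).
by apply: (le_lt_trans (xy k)); rewrite ltr_pdivrMr// ltr_pMr// ltr1n.
Qed.

End TestFunctions.

Lemma test_function_slice (R : realType) n (f : 'rV[R]_n.+1 -> R) (a : R) :
  test_function f -> test_function (fun v => f (row_cons a v)).
Proof.
move=> tf; split=> [|v vu]; last by apply: tf.2 => /unit_cube_row_cons[].
apply: cube_modulus_continuous => e /(test_function_modulus tf)[h h0 fh].
by exists h => // v w vw; apply/fh/cube_row_cons => //; rewrite subrr normr0 ltW.
Qed.

Lemma test_function_slice0 (R : realType) n (f : 'rV[R]_n.+1 -> R) (a : R) :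
  test_function f -> ~~ (0 < a < 1) -> (fun v => f (row_cons a v)) = fun=> 0.
Proof.
move=> [_ f0] /negP a01; apply/funext => v.
by apply: f0 => /unit_cube_row_cons[].
Qed.

Section IteratedIntegrals.
Context {R : realType}.
Implicit Types (N n : nat) (e : R).
Local Notation mu := (@lebesgue_measure R).

Lemma ler_norm_lim (u : R^nat) (l e : R) : u @ \oo --> l ->
  (\forall N \near \oo, `|u N| <= e) -> `|l| <= e.
Proof. by move=> ul ue; apply: (ler_cvg_to (cvg_norm ul) (cvg_cst e)). Qed.

Lemma cvg_midpoint_mean (g : R -> R) : continuous g ->
  (forall x : R, ~~ (0 < x < 1) -> g x = 0) ->
  midpoint_mean N g @[N --> \oo] --> \int[mu]_(x in `]0%R, +oo[) g x.
Proof.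
move=> gc g0; apply/cvgrPdist_le => e e0.
have g_out x : ~ `[0, 1]%classic x -> g x = 0.
  move=> /negP; rewrite in_itv/= => x01; apply: g0.
  by apply: contra x01 => /andP[/ltW -> /ltW ->].
have gu := unif_continuous_cst_outside_compact (@segment_compact R 0 1) gc g_out.
have /unif_continuousP/(_ e e0)[d d0 gd] := gu.
have d2 : 0 < d / 2 by rewrite divr_gt0.
apply: filterS (near_invS_le d2) => N Nd; apply: Rintegral_midpoint_error => // x y xy.
apply/ltW/(gd (x, y)); apply: (le_lt_trans xy); apply: (le_lt_trans Nd).
by rewrite ltr_pdivrMr// ltr_pMr// ltr1n.
Qed.

Lemma ler_dist_Rintegral (f g : R -> R) e : continuous f -> continuous g ->
  (forall x : R, ~~ (0 < x < 1) -> f x = 0) ->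
  (forall x : R, ~~ (0 < x < 1) -> g x = 0) ->
  (forall x, `|f x - g x| <= e) ->
  `|\int[mu]_(x in `]0%R, +oo[) f x - \int[mu]_(x in `]0%R, +oo[) g x| <= e.
Proof.
move=> fc gc f0 g0 fge.
apply: (ler_norm_lim (cvgB (cvg_midpoint_mean fc f0) (cvg_midpoint_mean gc g0))).
near=> N; rewrite -[X in `|X|]/(midpoint_mean N f - midpoint_mean N g).
by rewrite -midpoint_meanB; exact: ler_norm_midpoint_mean.
Unshelve. all: by end_near. Qed.

Definition sup_contraction n (I : ('rV[R]_n -> R) -> R) :=
  forall f g e, test_function f -> test_function g ->
    (forall x, `|f x - g x| <= e) -> `|I f - I g| <= e.

Lemma ler_dist_slice n (I : ('rV[R]_n -> R) -> R) f e h (a b : R) :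
  sup_contraction I -> test_function f -> 0 <= h ->
  (forall x y, cube y h x -> `|f x - f y| <= e) -> `|a - b| <= h ->
  `|I (fun v => f (row_cons a v)) - I (fun v => f (row_cons b v))| <= e.
Proof.
move=> I_contr tf h0 fh ab; apply: I_contr => [||v]; try exact: test_function_slice.
by apply/fh/cube_row_cons => // k; rewrite subrr normr0.
Qed.

Lemma continuous_slice n (I : ('rV[R]_n -> R) -> R) f :
  sup_contraction I -> test_function f ->
  continuous (fun a => I (fun v => f (row_cons a v))).
Proof.
move=> I_contr tf a; apply/cvgrPdist_le => e /(test_function_modulus tf)[h h0 fh].
apply/nbhs_ballP; exists h => // b /ltW ab.
exact: (ler_dist_slice I_contr tf (ltW h0) fh ab).
Qed.

Lemma iter_integral0 n : iter_integral (fun _ : 'rV[R]_n => 0) = 0.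
Proof.
elim: n => [//|n IH] /=; under eq_Rintegral do rewrite IH.
by rewrite Rintegral_cst ?mul0r.
Qed.

Lemma iter_integral_slice0 n (f : 'rV[R]_n.+1 -> R) (a : R) : test_function f ->
  ~~ (0 < a < 1) -> iter_integral (fun v => f (row_cons a v)) = 0.
Proof. by move=> tf a01; rewrite (test_function_slice0 tf a01) iter_integral0. Qed.

Lemma sup_contraction_iter_integral n : sup_contraction (@iter_integral R n).
Proof.
elim: n => [|n IH] f g e tf tg fge; first exact: fge.
apply: ler_dist_Rintegral.
- exact: (continuous_slice IH tf).
- exact: (continuous_slice IH tg).
- by move=> a; exact: (iter_integral_slice0 tf).
- by move=> a; exact: (iter_integral_slice0 tg).
- by move=> a; apply: IH => [||v]; try exact: test_function_slice.
Qed.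

Lemma iter_integral_riemann_error n (f : 'rV[R]_n -> R) e N : test_function f ->
  (forall x y, cube y N.+1%:R^-1 x -> `|f x - f y| <= e) ->
  `|iter_integral f - riemann_sum N f| <= n%:R * e.
Proof.
elim: n f => [|n IH] f tf fe; first by rewrite /= subrr normr0 mul0r.
have contr := @sup_contraction_iter_integral n.
pose G a := iter_integral (fun v => f (row_cons a v)).
have outer_error : `|iter_integral f - midpoint_mean N G| <= e.
  apply: Rintegral_midpoint_error; first exact: (continuous_slice contr tf).
    by move=> a; exact: (iter_integral_slice0 tf).
  by move=> a b ab; apply: (ler_dist_slice contr tf _ fe ab); rewrite invr_ge0.
rewrite (le_trans (ler_distD (midpoint_mean N G) _ _))// -[in leRHS]natr1 mulrDl mul1r.
rewrite addrC lerD//= -midpoint_meanB; apply: ler_norm_midpoint_mean => a _.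
apply: IH => [|v w vw]; first exact: test_function_slice.
by apply/fe/cube_row_cons => //; rewrite subrr normr0 invr_ge0.
Qed.

Lemma cvg_riemann_sum n (f : 'rV[R]_n -> R) : test_function f ->
  riemann_sum N f @[N --> \oo] --> iter_integral f.
Proof.
move=> tf; apply/cvgrPdist_le => e e0.
have n1 : 0 < n.+1%:R :> R by rewrite ltr0Sn.
have [h h0 fh] := test_function_modulus tf (divr_gt0 e0 n1).
apply: filterS (near_invS_le h0) => N Nh; apply: (@le_trans _ _ (n%:R * (e / n.+1%:R))).
  by apply: iter_integral_riemann_error => // x y /(cubeS Nh); exact: fh.
by rewrite mulrCA ger_pMr// ler_pdivrMr// mul1r ler_nat.
Qed.

Lemma iter_integralD n (f g : 'rV[R]_n -> R) : test_function f -> test_function g ->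
  iter_integral (fun x => f x + g x) = iter_integral f + iter_integral g.
Proof.
move=> tf tg; apply: (norm_cvg_unique (cvg_riemann_sum (test_functionD tf tg))).
rewrite /= (eq_cvg _ _ (fun N => riemann_sumD N f g)).
exact: cvgD (cvg_riemann_sum tf) (cvg_riemann_sum tg).
Qed.

Lemma iter_integralZ n (c : R) (f : 'rV[R]_n -> R) : test_function f ->
  iter_integral (fun x => c * f x) = c * iter_integral f.
Proof.
move=> tf; apply: (norm_cvg_unique (cvg_riemann_sum (test_functionZ c tf))).
rewrite /= (eq_cvg _ _ (fun N => riemann_sumZ N c f)).
exact: cvgM (cvg_cst c) (cvg_riemann_sum tf).
Qed.

Lemma iter_integral_sum n I (s : seq I) (F : I -> 'rV[R]_n -> R) :
  (forall i, test_function (F i)) ->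
  iter_integral (fun x => \sum_(i <- s) F i x) = \sum_(i <- s) iter_integral (F i).
Proof.
move=> tF; elim: s => [|i s IH].
  by under eq_fun do rewrite big_nil; rewrite big_nil iter_integral0.
rewrite big_cons -IH -iter_integralD//; last exact: test_function_sum.
by under eq_fun do rewrite big_cons.
Qed.

Lemma ler_norm_iter_integral n (f : 'rV[R]_n -> R) e : test_function f ->
  (\forall N \near \oo, riemann_sum N (fun x => `|f x|) <= e) ->
  `|iter_integral f| <= e.
Proof.
move=> tf fe; apply: (ler_norm_lim (cvg_riemann_sum tf)); apply: filterS fe => N.
apply: le_trans; rewrite ler_norml -mulN1r -riemann_sumZ; apply/andP; split.
  by apply: ler_riemann_sum => x _; rewrite mulN1r lerNl -normrN ler_norm.
by apply: ler_riemann_sum => x _; exact: ler_norm.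
Qed.

End IteratedIntegrals.

(** * Directional derivatives and integration by parts *)

Section DirectionalDerivatives.
Context {R : realType} {V : normedModType R}.
Implicit Types (f : V -> R) (x v : V).

Lemma is_derive_line (W : normedModType R) (f : V -> W) x v (s : R) (df : W) :
  is_derive (x + s *: v) v f df <-> is_derive s (1 : R) (fun s => f (x + s *: v)) df.
Proof.
pose g u := f (x + u *: v).
have quotientE : (fun h : R => h^-1 *: ((f \o shift (x + s *: v)) (h *: v) - g s)) =
    fun h : R => h^-1 *: ((g \o shift s) (h *: (1 : R)) - g s).
  apply/funext => h /=; congr (_ *: (f _ - _)).
  by rewrite [_%:A]mulr1 scalerDl addrCA.
by split=> -[fd fE]; apply: DeriveDef; move: fd fE;
  rewrite /derivable /derive quotientE.
Qed.

Lemma is_derive_line0 (W : normedModType R) (f : V -> W) x v (df : W) :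
  is_derive x v f df <-> is_derive (0 : R) (1 : R) (fun s => f (x + s *: v)) df.
Proof. by have := is_derive_line f x v 0 df; rewrite scale0r addr0. Qed.

Lemma is_derive_comp (h : R -> R) f x v (dh df : R) :
  is_derive x v f df -> is_derive (f x) (1 : R) h dh ->
  is_derive x v (fun y => h (f y)) (dh * df).
Proof.
move=> /is_derive_line0 f_line hd; apply/is_derive_line0.
by apply: is_derive1_comp; rewrite scale0r addr0.
Qed.

Lemma is_deriveV f x v (df : R) : f x != 0 -> is_derive x v f df ->
  is_derive x v (fun y => (f y)^-1) (- (f x)^-1 ^+ 2 * df).
Proof.
move=> fx0 [fd fE]; apply: (DeriveDef (derivableV fx0 fd)).
by rewrite deriveV// fE exprVn.
Qed.

End DirectionalDerivatives.

Section CoordinateDerivatives.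
Context {R : realType} {n : nat}.
Implicit Types (f : 'rV[R]_n -> R) (x v : 'rV[R]_n) (k : 'I_n).

Lemma is_derive_coord x v k : is_derive x v (fun y : 'rV[R]_n => y ord0 k) (v ord0 k).
Proof.
apply/is_derive_line0; under eq_fun do rewrite !mxE.
apply: (is_derive_eq (is_deriveD (is_derive_cst (x ord0 k) (0 : R) 1)
  (is_deriveM (is_derive_id (0 : R) 1) (is_derive_cst (v ord0 k) (0 : R) 1)))).
by rewrite scaler0 !add0r [_ *: _]mulr1.
Qed.

Lemma is_derive_set_coord f x k (a df : R) :
  is_derive (set_coord x k a) (delta_mx ord0 k) f df ->
  is_derive a (1 : R) (fun a => f (set_coord x k a)) df.
Proof.
rewrite set_coord_line => /is_derive_line.
by under eq_fun do rewrite -set_coord_line.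
Qed.

Lemma iter_integral_derive k f (f' : 'rV[R]_n -> R) :
  test_function f -> test_function f' ->
  (forall x, unit_cube x -> is_derive x (delta_mx ord0 k) f (f' x)) ->
  iter_integral f' = 0.
Proof.
move=> tf tf' ff'; apply/eqP; rewrite -normr_le0; apply/ler_addgt0Pr => e e0.
rewrite add0r; apply: (ler_norm_lim (cvg_riemann_sum tf')).
have [h h0 f'h] := test_function_modulus tf' e0.
apply: filterS (near_invS_le h0) => N Nh; rewrite -(riemann_sum_coord_mean N k).
apply: ler_norm_riemann_sum => x xu; pose G (a : R) := f (set_coord x k a).
have G_out (a : R) : ~~ (0 < a < 1) -> G a = 0.
  by move=> a01; apply: tf.2 => /(_ k); rewrite set_coordE; exact/negP.
have := @antiderivative_midpoint_error _ N G (fun a => f' (set_coord x k a)) e.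
rewrite !G_out ?ltxx ?andbF// subrr sub0r normrN; apply.
- apply: continuous_subspaceT => a; apply/cvgrPdist_le => d d0.
  have [r r0 fr] := test_function_modulus tf d0.
  by apply/nbhs_ballP; exists r => // b /ltW ab; apply/fr/cube_set_coord.
- by move=> a a01; apply/is_derive_set_coord/ff'/unit_cube_set_coord.
- by move=> a b ab; apply/f'h/cube_set_coord/(le_trans ab).
Qed.

End CoordinateDerivatives.

Section TwoByTwoSystems.
Context {R : realType}.

Lemma det2_lower_bound (a b c e u v : R) :
  (a * e - b * c) ^+ 2 * (u ^+ 2 + v ^+ 2) <=
  (a ^+ 2 + b ^+ 2 + c ^+ 2 + e ^+ 2) *
    ((a * u + b * v) ^+ 2 + (c * u + e * v) ^+ 2).
Proof.
set P := a * u + b * v; set Q := c * u + e * v.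
rewrite -subr_ge0.
have -> : (a ^+ 2 + b ^+ 2 + c ^+ 2 + e ^+ 2) * (P ^+ 2 + Q ^+ 2) -
    (a * e - b * c) ^+ 2 * (u ^+ 2 + v ^+ 2) =
    (e * Q + b * P) ^+ 2 + (a * P + c * Q) ^+ 2.
  by rewrite /P /Q; ring.
by rewrite addr_ge0 ?sqr_ge0.
Qed.

Lemma near_det2_lower_bound T (F : set_system T) {FF : Filter F}
    (a b c e : T -> R) (a0 b0 c0 e0 : R) :
  a @ F --> a0 -> b @ F --> b0 -> c @ F --> c0 -> e @ F --> e0 ->
  a0 * e0 - b0 * c0 != 0 ->
  exists2 m : R, 0 < m & \forall t \near F, forall u v : R,
    m * (u ^+ 2 + v ^+ 2) <= (a t * u + b t * v) ^+ 2 + (c t * u + e t * v) ^+ 2.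
Proof.
move=> cva cvb cvc cve; set det0 := (X in X != 0) => det0_neq0.
pose norm0 := a0 ^+ 2 + b0 ^+ 2 + c0 ^+ 2 + e0 ^+ 2.
have det0_half : det0 ^+ 2 / 2 < det0 ^+ 2.
  by rewrite ltr_pdivrMr// ltr_pMr ?ltr1n// exprn_even_gt0.
have norm0_lt : norm0 < norm0 + 1 by rewrite ltrDl.
have norm1_gt0 : 0 < norm0 + 1 by rewrite ltr_wpDl// !addr_ge0 ?sqr_ge0.
have sqr_cvg (g : T -> R) (l : R) : g @ F --> l -> g t ^+ 2 @[t --> F] --> l ^+ 2.
  by move=> gl; exact: (cvgM gl gl).
have det_cvg : (a t * e t - b t * c t) ^+ 2 @[t --> F] --> det0 ^+ 2.
  by apply: sqr_cvg; apply: cvgB; exact: cvgM.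
have norm_cvg : a t ^+ 2 + b t ^+ 2 + c t ^+ 2 + e t ^+ 2 @[t --> F] --> norm0.
  by do 3?[apply: cvgD]; exact: sqr_cvg.
exists (det0 ^+ 2 / 2 / (norm0 + 1)).
  by rewrite !divr_gt0// exprn_even_gt0.
near=> t => u v.
have det_t : det0 ^+ 2 / 2 <= (a t * e t - b t * c t) ^+ 2.
  by apply: ltW; near: t; exact: cvgr_gt det0_half.
have norm_t : a t ^+ 2 + b t ^+ 2 + c t ^+ 2 + e t ^+ 2 <= norm0 + 1.
  by apply: ltW; near: t; exact: cvgr_lt norm0_lt.
rewrite mulrAC ler_pdivrMr// [leRHS]mulrC.
apply: le_trans (ler_wpM2r _ det_t) _; first by rewrite addr_ge0 ?sqr_ge0.
apply: le_trans (det2_lower_bound _ _ _ _ _ _) (ler_wpM2r _ norm_t).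
by rewrite addr_ge0 ?sqr_ge0.
Unshelve. all: by end_near. Qed.

End TwoByTwoSystems.

(** * Logarithmic derivatives of polynomials *)

Section PolynomialFunctions.
Context {R : realType} {n : nat}.
Implicit Types (p q : {mpoly R[n]}) (x y v : 'rV[R]_n) (j k : 'I_n).

Lemma mpoly_ring_ind (P : {mpoly R[n]} -> Prop) :
  (forall c, P c%:MP) -> (forall i, P 'X_i) ->
  (forall p q, P p -> P q -> P (p + q)) ->
  (forall p q, P p -> P q -> P (p * q)) -> forall p, P p.
Proof.
move=> PC PX PD PM p; rewrite (mpolyE p).
apply: big_ind; [by rewrite -(mpolyC0 n R)|exact: PD|].
move=> m _; rewrite -mul_mpolyC; apply: (PM _ _ (PC _)); rewrite mpolyXE_id.
apply: big_ind; [by rewrite -(mpolyC1 n R)|exact: PM|].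
move=> i _; elim: (m i) => [|e IH]; first by rewrite expr0 -(mpolyC1 n R); exact: PC.
by rewrite exprS; exact: PM.
Qed.

Lemma continuous_meval p : continuous (fun x : 'rV[R]_n => p.@[x ord0]).
Proof.
elim/mpoly_ring_ind: p => [c|i|p q cp cq|p q cp cq].
- by under eq_fun do rewrite mevalC; exact: cst_continuous.
- by under eq_fun do rewrite mevalXU; exact: coord_continuous.
- by under eq_fun do rewrite mevalD; move=> x; exact: (cvgD (cp x) (cq x)).
- by under eq_fun do rewrite mevalM; move=> x; exact: (cvgM (cp x) (cq x)).
Qed.

Lemma is_derive_meval p x v : is_derive x v (fun y : 'rV[R]_n => p.@[y ord0])
  (\sum_l p^`M(l).@[x ord0] * v ord0 l).
Proof.
elim/mpoly_ring_ind: p => [c|i|p q dp dq|p q dp dq].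
- under eq_fun do rewrite mevalC; rewrite big1 => [|l _].
    exact: is_derive_cst.
  by rewrite mderivC meval0 mul0r.
- under eq_fun do rewrite mevalXU; apply: (is_derive_eq (is_derive_coord x v i)).
  rewrite (bigD1 i)//= big1 => [|l li]; last first.
    by rewrite mderivX mnm1E eq_sym (negbTE li) scale0r meval0 mul0r.
  rewrite mderivX mnm1E eqxx scale1r -{1}[U_(i)%MM]add0m addmK mpolyX0 meval1.
  by rewrite mul1r addr0.
- under eq_fun do rewrite mevalD.
  under eq_bigr do rewrite mderivD mevalD mulrDl.
  by rewrite big_split; exact: is_deriveD.
- under eq_fun do rewrite mevalM.
  apply: (is_derive_eq (is_deriveM dp dq)).
  rewrite -![_ *: _]/(_ * _) !mulr_sumr -big_split; apply: eq_bigr => l _ /=.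
  by rewrite mderivM mevalD !mevalM; ring.
Qed.

Lemma is_derive_meval_delta p x k :
  is_derive x (delta_mx ord0 k) (fun y : 'rV[R]_n => p.@[y ord0]) p^`M(k).@[x ord0].
Proof.
apply: (is_derive_eq (is_derive_meval p x _)); rewrite (bigD1 k)//= big1 => [|l lk].
  by rewrite mxE !eqxx mulr1 addr0.
by rewrite mxE (negbTE lk) andbF mulr0.
Qed.

Lemma meval_MVT p x y : exists2 s : R, 0 <= s <= 1 &
  p.@[x ord0] - p.@[y ord0] =
  \sum_l p^`M(l).@[(y + s *: (x - y)) ord0] * (x ord0 l - y ord0 l).
Proof.
pose g s := p.@[(y + s *: (x - y)) ord0].
pose g' s := \sum_l p^`M(l).@[(y + s *: (x - y)) ord0] * (x - y) ord0 l.
have gd s : is_derive s (1 : R) g (g' s).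
  by apply/(is_derive_line (fun z : 'rV[R]_n => p.@[z ord0]))/is_derive_meval.
have [|s s01 gE] := @MVT_segment R g g' 0 1 ler01 (fun s _ => gd s).
  apply: continuous_subspaceT => s.
  by apply/differentiable_continuous/derivable1_diffP; case: (gd s).
exists s; first by move: s01; rewrite in_itv.
move: gE; rewrite /g scale1r scale0r addr0 subrKC subr0 mulr1 => ->.
by apply: eq_bigr => l _; rewrite !mxE.
Qed.

Definition logderiv k p : {mpoly R[n]} := 'X_k * p^`M(k).

Lemma logderivX k (m : 'X_{1..n}) :
  logderiv k ('X_[m] : {mpoly R[n]}) = (m k)%:R *: 'X_[m].
Proof.
rewrite /logderiv mderivX -scalerAr.
have [->|mk] := posnP (m k); first by rewrite !scale0r.
by rewrite -mpolyXD addmC submK// lep1mP -lt0n.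
Qed.

Lemma logderivE k p :
  logderiv k p = \sum_(m <- msupp p) (p@_m * (m k)%:R) *: 'X_[m].
Proof.
rewrite {1}(mpolyE p) /logderiv raddf_sum mulr_sumr /=; apply: eq_bigr => m _.
by rewrite mderivZ -scalerAr -/(logderiv k _) logderivX scalerA.
Qed.

Lemma dhomog_logderiv d k p : p \is d.-homog -> logderiv k p \is d.-homog.
Proof.
move=> /dhomogP hp; rewrite logderivE big_seq rpred_sum// => m /hp md.
by apply: dhomogZ; rewrite dhomogX md.
Qed.

Lemma sum_logderiv_dhomog d p : p \is d.-homog -> \sum_k logderiv k p = d%:R *: p.
Proof.
move=> /dhomogP hp; under eq_bigr do rewrite logderivE.
rewrite exchange_big [in RHS](mpolyE p) scaler_sumr big_seq [RHS]big_seq /=.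
apply: eq_bigr => m /hp md; rewrite -scaler_suml -mulr_sumr -natr_sum -mdegE.
by rewrite [mdeg m]md scalerA mulrC.
Qed.

Definition jacobian p q j k := p^`M(j) * q^`M(k) - p^`M(k) * q^`M(j).

Lemma jacobian_contract d p q j : p \is d.-homog -> q \is d.-homog ->
  \sum_k 'X_k * jacobian p q j k = d%:R *: (p^`M(j) * q - p * q^`M(j)).
Proof.
move=> hp hq; rewrite scalerBr scalerAr scalerAl.
rewrite -(sum_logderiv_dhomog hp) -(sum_logderiv_dhomog hq).
rewrite mulr_sumr mulr_suml -sumrB; apply: eq_bigr => k _.
by rewrite /jacobian /logderiv; ring.
Qed.

Lemma sum_jacobian_logderiv d p q j k : p \is d.-homog ->
  \sum_i jacobian (logderiv i p) q j k = d%:R *: jacobian p q j k.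
Proof.
move=> hp; rewrite sumrB -!mulr_suml -!raddf_sum /= (sum_logderiv_dhomog hp).
by rewrite !mderivZ -!scalerAl scalerBr.
Qed.

(* If all these minors vanished, summing them over [i] by Euler's identity would
   kill the minors of [p] and [x_j p_j], whose contraction with [x] is
   [d x_j p_j ^ 2] at a zero of [p]. *)
Lemma exists_log_hessian_minor d p j x : (0 < d)%N -> p \is d.-homog ->
  x ord0 j != 0 -> p.@[x ord0] = 0 -> p^`M(j).@[x ord0] != 0 ->
  exists i k, (jacobian (logderiv i p) (logderiv j p) j k).@[x ord0] != 0.
Proof.
move=> d0 hp xj px pj; apply: contrapT => /forallNP no_minor.
have minor0 k : (jacobian p (logderiv j p) j k).@[x ord0] = 0.
  have : d%:R * (jacobian p (logderiv j p) j k).@[x ord0] = 0.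
    rewrite -mevalZ -sum_jacobian_logderiv// raddf_sum big1// => i _.
    by apply/eqP; apply: contra_notT (no_minor i) => ?; exists k.
  by move/eqP; rewrite mulf_eq0 pnatr_eq0 gtn_eqF// => /eqP.
have /(congr1 (meval (x ord0))) := jacobian_contract j hp (dhomog_logderiv j hp).
rewrite mevalZ mevalB !mevalM px mul0r subr0 raddf_sum big1 => [/eqP|k _]; last first.
  by rewrite /= mevalM minor0 mulr0.
by rewrite mevalXU eq_sym !mulf_eq0 pnatr_eq0 gtn_eqF// (negbTE pj) (negbTE xj).
Qed.

Lemma nbhs_cube x (A : set 'rV[R]_n) : nbhs x A ->
  exists2 h : R, 0 < h & cube x h `<=` A.
Proof.
move=> /nbhs_ballP[r /= r0 rA]; exists (r / 2); first by rewrite divr_gt0.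
move=> y xy; apply: rA; split=> // i k; rewrite (ord1 i) /ball /= distrC.
by apply: (le_lt_trans (xy k)); rewrite ltr_pdivrMr// ltr_pMr// ltr1n.
Qed.

Lemma cube_segment x0 x y (h s : R) : 0 <= s <= 1 -> cube x0 h x -> cube x0 h y ->
  cube x0 h (y + s *: (x - y)).
Proof.
move=> /andP[s0 s1] xh yh k; rewrite !mxE.
have -> : y ord0 k + s * (x ord0 k - y ord0 k) - x0 ord0 k =
  (1 - s) * (y ord0 k - x0 ord0 k) + s * (x ord0 k - x0 ord0 k) by ring.
rewrite (le_trans (ler_normD _ _))// !normrM (ger0_norm s0) ger0_norm ?subr_ge0//.
have := ler_wpM2l s0 (xh k); have s'0 : 0 <= 1 - s by rewrite subr_ge0.
by have := ler_wpM2l s'0 (yh k); lra.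
Qed.

Lemma two_coordinate_lower_bound p q j k x0 : (jacobian p q j k).@[x0 ord0] != 0 ->
  exists2 c : R, 0 < c & exists2 h : R, 0 < h & forall x y,
    cube x0 h x -> cube x0 h y -> (forall l, l != j -> l != k -> x ord0 l = y ord0 l) ->
    c * ((x ord0 j - y ord0 j) ^+ 2 + (x ord0 k - y ord0 k) ^+ 2) <=
    (p.@[x ord0] - p.@[y ord0]) ^+ 2 + (q.@[x ord0] - q.@[y ord0]) ^+ 2.
Proof.
move=> det0; have kj : k != j.
  by apply: contra_neq det0 => ->; rewrite /jacobian subrr meval0.
pose F := filter_prod (nbhs x0) (nbhs x0).
have F_filter : Filter F by apply: filter_prod_filter; exact: nbhs_filter.
have cvg1 r : (fun z : 'rV[R]_n * 'rV[R]_n => r.@[z.1 ord0]) @ F --> r.@[x0 ord0].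
  apply: (cvg_comp fst (fun x : 'rV[R]_n => r.@[x ord0]) cvg_fst).
  exact: continuous_meval.
have cvg2 r : (fun z : 'rV[R]_n * 'rV[R]_n => r.@[z.2 ord0]) @ F --> r.@[x0 ord0].
  apply: (cvg_comp snd (fun x : 'rV[R]_n => r.@[x ord0]) cvg_snd).
  exact: continuous_meval.
have [|c c0 [[A B] /= [xA xB] AB]] := near_det2_lower_bound
    (cvg1 p^`M(j)) (cvg1 p^`M(k)) (cvg2 q^`M(j)) (cvg2 q^`M(k)).
  by move: det0; rewrite /jacobian mevalB !mevalM.
have [h h0 hAB] := nbhs_cube (filterI xA xB).
exists c => //; exists h => // x y xh yh xy.
have increment r : exists2 z, cube x0 h z & r.@[x ord0] - r.@[y ord0] =
    r^`M(j).@[z ord0] * (x ord0 j - y ord0 j) +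
    r^`M(k).@[z ord0] * (x ord0 k - y ord0 k).
  have [s s01 ->] := meval_MVT r x y.
  exists (y + s *: (x - y)); first exact: cube_segment.
  rewrite (bigD1 j)//= (bigD1 k)//= big1 ?addr0// => l /andP[lj lk].
  by rewrite xy// subrr mulr0.
have [z zh ->] := increment p; have [w wh ->] := increment q.
exact: (AB (z, w) (conj (hAB z zh).1 (hAB w wh).2)).
Qed.

Lemma dhomog_log_gradient_lower_bound d p x0 :
  (0 < d)%N -> p \is d.-homog -> (forall k, x0 ord0 k != 0) -> p.@[x0 ord0] = 0 ->
  (exists j, p^`M(j).@[x0 ord0] != 0) ->
  exists j k c h, [/\ k != j, 0 < c, 0 < h & forall x y,
    cube x0 h x -> cube x0 h y -> (forall l, l != j -> l != k -> x ord0 l = y ord0 l) ->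
    c * ((x ord0 j - y ord0 j) ^+ 2 + (x ord0 k - y ord0 k) ^+ 2) <=
    \sum_l ((logderiv l p).@[x ord0] - (logderiv l p).@[y ord0]) ^+ 2].
Proof.
move=> d0 hp x0_neq0 px0 [j pj].
have [i [k minor]] := exists_log_hessian_minor d0 hp (x0_neq0 j) px0 pj.
have ij : i != j.
  by apply: contra_neq minor => ->; rewrite /jacobian mulrC subrr meval0.
have kj : k != j.
  by apply: contra_neq minor => ->; rewrite /jacobian subrr meval0.
have [c c0 [h h0 lower]] := two_coordinate_lower_bound minor.
exists j, k, c, h; split=> // x y xh yh xy; apply: le_trans (lower x y xh yh xy) _.
rewrite (bigD1 i)//= (bigD1 j) 1?eq_sym//= addrA lerDl.
by rewrite sumr_ge0// => l _; exact: sqr_ge0.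
Qed.

End PolynomialFunctions.

Lemma nbhs_closedC (T : topologicalType) (K : set T) (x : T) :
  closed K -> ~ K x -> nbhs x (~` K).
Proof. by move=> cK xK; apply: open_nbhs_nbhs; split=> //; exact: closed_openC. Qed.

Section SmoothCompactSupport.
Context {R : realType} {n : nat}.
Variables (varpi : 'rV[R]_n -> R) (K : set 'rV[R]_n).
Hypothesis varpi_smooth : smooth varpi.

Lemma is_derive_iter_partial (s : seq 'I_n) k x :
  is_derive x (delta_mx ord0 k) (iter_partial s varpi) (iter_partial (k :: s) varpi x).
Proof. by apply: derivableP; have [_] := varpi_smooth s; apply. Qed.

Lemma continuous_iter_partial (s : seq 'I_n) : continuous (iter_partial s varpi).
Proof. by have [] := varpi_smooth s. Qed.

Lemma iter_partial_out (s : seq 'I_n) : closed K -> fsupport varpi `<=` K ->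
  forall x, ~ K x -> iter_partial s varpi x = 0.
Proof.
move=> cK sK; elim: s => [|k s IH] x xK /=.
  apply/eqP; apply: contra_notT xK => vx.
  by apply: sK; exact: subset_closure.
rewrite /partial (@near_eq_derive _ _ _ _ (cst 0)) ?derive_cst//.
have := nbhs_closedC cK xK.
exact: (@filterS _ _ (nbhs_filter x) _ _ (fun y => IH y)).
Qed.

End SmoothCompactSupport.

Section LogarithmicForms.
Context {R : realType} {n : nat}.
Implicit Types (c : 'I_n -> R) (x : 'rV[R]_n) (k : 'I_n).

Lemma continuous_at_sum (T : topologicalType) I (s : seq I) (F : I -> T -> R) (x : T) :
  (forall i, {for x, continuous (F i)}) ->
  {for x, continuous (fun y => \sum_(i <- s) F i y)}.
Proof.
move=> Fc; have sum_cvg := @cvg_big R I +%R 0 xpredT (@add_continuous R) T (nbhs x) s F.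
by apply: (sum_cvg (fun i => F i x) _) => i _; exact: Fc.
Qed.

Definition log_form c x : R := \sum_k c k * ln (x ord0 k).

Lemma is_derive_log_form c k x : unit_cube x ->
  is_derive x (delta_mx ord0 k) (log_form c) (c k / x ord0 k).
Proof.
move=> xu; have dln l : is_derive x (delta_mx ord0 k)
    (c l \*: (fun y : 'rV[R]_n => ln (y ord0 l)))
    (c l *: ((x ord0 l)^-1 * (delta_mx ord0 k : 'rV[R]_n) ord0 l)).
  apply/is_deriveZ/is_derive_comp; first exact: is_derive_coord.
  by apply: is_derive1_ln; have /andP[] := xu l.
have := is_derive_sum dln; rewrite (_ : \sum_(i < n) _ = log_form c); last first.
  by apply/funext => y; rewrite fct_sumE.
move/is_derive_eq; apply; rewrite (bigD1 k)//= big1 => [|l lk].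
  by rewrite addr0 mxE !eqxx mulr1.
by rewrite mxE (negbTE lk) andbF mulr0 scaler0.
Qed.

Lemma continuous_ln_coord k x : unit_cube x ->
  {for x, continuous (fun y : 'rV[R]_n => ln (y ord0 k))}.
Proof.
move=> xu; apply: (@continuous_comp _ _ _ (fun y : 'rV[R]_n => y ord0 k) (@ln R)).
  exact: coord_continuous.
by apply: continuous_ln; have /andP[] := xu k.
Qed.

Lemma continuous_log_form c x : unit_cube x -> {for x, continuous (log_form c)}.
Proof.
move=> xu; apply: continuous_at_sum => k.
apply: (@continuousM _ _ (fun=> c k) (fun y : 'rV[R]_n => ln (y ord0 k))).
  exact: cst_continuous.
exact: continuous_ln_coord.
Qed.

End LogarithmicForms.

Lemma compact_bounded_image (R : realType) (T : topologicalType) (K : set T)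
    (g : T -> R) :
  compact K -> (forall x, K x -> {for x, continuous g}) ->
  exists C, forall x, K x -> `|g x| <= C.
Proof.
move=> cK gc; have gK : {within K, continuous g}.
  by apply: continuous_in_subspaceT => x /set_mem; exact: gc.
have [M [_ MgK]] := compact_bounded (continuous_compact gK cK).
exists (M + 1) => x Kx; apply: MgK; first by rewrite ltrDl.
by exists x.
Qed.

(** * Symbol calculus and oscillatory integrals *)

Section Symbols.
Context {R : realType} {n : nat}.
Variables (f : {mpoly R[n]}) (B : R) (K : set 'rV[R]_n).
Implicit Types (x : 'rV[R]_n) (j k l : 'I_n) (Z : set 'rV[R]_n) (N m : nat).

Record params := Params {
  freq : R;
  expo : 'I_n -> R;
  twist : 'I_n -> R;
  expo_le : forall k, `|expo k| <= B }.

Implicit Types (P : params) (a b : params -> 'rV[R]_n -> R).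

Definition phase P x : R := freq P * f.@[x ord0] + log_form (twist P) x.

Definition scale P : R := Num.sqrt (1 + `|freq P|)^-1.

Definition slope k P : {mpoly R[n]} :=
  scale P *: (freq P *: logderiv k f + (twist P k)%:MP).

Definition energy P : {mpoly R[n]} := \sum_k slope k P ^+ 2.

Definition localizer P x : R := (1 + (energy P).@[x ord0])^-1.

Definition field k P x : R := (slope k P).@[x ord0] * localizer P x.

Definition gauge P x : R := Num.sqrt (localizer P x + scale P ^+ 2).

Lemma scale_gt0 P : 0 < scale P.
Proof. by rewrite sqrtr_gt0 invr_gt0 ltr_wpDr. Qed.

Lemma scale_neq0 P : scale P != 0.
Proof. by rewrite gt_eqF// scale_gt0. Qed.

Lemma sqr_scale P : scale P ^+ 2 = (1 + `|freq P|)^-1.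
Proof. by rewrite sqr_sqrtr// invr_ge0 addr_ge0. Qed.

Lemma energyE P x : (energy P).@[x ord0] = \sum_k (slope k P).@[x ord0] ^+ 2.
Proof. by rewrite raddf_sum; apply: eq_bigr => k _; rewrite /= !expr2 mevalM. Qed.

Lemma energy_ge0 P x : 0 <= (energy P).@[x ord0].
Proof. by rewrite energyE sumr_ge0// => k _; exact: sqr_ge0. Qed.

Lemma energy1_gt0 P x : 0 < 1 + (energy P).@[x ord0].
Proof. by rewrite ltr_wpDr// energy_ge0. Qed.

Lemma energy1_neq0 P x : 1 + (energy P).@[x ord0] != 0.
Proof. by rewrite gt_eqF// energy1_gt0. Qed.

Lemma localizer_ge0 P x : 0 <= localizer P x.
Proof. by rewrite invr_ge0 ltW// energy1_gt0. Qed.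

Lemma localizer_le1 P x : localizer P x <= 1.
Proof. by rewrite invf_le1 ?energy1_gt0// lerDl energy_ge0. Qed.

Lemma localizerM_energy P x : localizer P x * (energy P).@[x ord0] = 1 - localizer P x.
Proof. by rewrite /localizer; field; exact: energy1_neq0. Qed.

Lemma sum_field_slope P x :
  \sum_k field k P x * (slope k P).@[x ord0] = 1 - localizer P x.
Proof.
rewrite -localizerM_energy energyE mulr_sumr; apply: eq_bigr => k _.
by rewrite /field; ring.
Qed.

Lemma gauge_ge0 P x : 0 <= gauge P x.
Proof. exact: sqrtr_ge0. Qed.

Lemma sqr_gauge P x : gauge P x ^+ 2 = localizer P x + scale P ^+ 2.
Proof. by rewrite sqr_sqrtr// addr_ge0 ?sqr_ge0 ?localizer_ge0. Qed.

Lemma localizer_le_gauge P x : `|localizer P x| <= gauge P x ^+ 2.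
Proof. by rewrite ger0_norm ?localizer_ge0// sqr_gauge lerDl sqr_ge0. Qed.

Lemma scale_le_gauge P x : `|scale P| <= gauge P x.
Proof.
rewrite -(@ler_pXn2r _ 2)// ?nnegrE ?gauge_ge0// real_normK ?num_real//.
by rewrite sqr_gauge lerDr localizer_ge0.
Qed.

Lemma field_le_gauge k P x : `|field k P x| <= gauge P x.
Proof.
rewrite -(@ler_pXn2r _ 2)// ?nnegrE ?gauge_ge0// real_normK ?num_real// sqr_gauge.
apply: (@le_trans _ _ (localizer P x)); last by rewrite lerDl sqr_ge0.
rewrite exprMn expr2 mulrA mulrC -[leRHS]mulr1 ler_wpM2l ?localizer_ge0//= mulrC.
apply: (@le_trans _ _ (localizer P x * (energy P).@[x ord0])).
  rewrite ler_wpM2l ?localizer_ge0//= energyE (bigD1 k)//= lerDl.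
  by rewrite sumr_ge0// => l _; exact: sqr_ge0.
by rewrite localizerM_energy gerBl localizer_ge0.
Qed.

Definition bounded_symbol Z m a :=
  [/\ forall P x, unit_cube x -> {for x, continuous (a P)},
      forall P x, ~ Z x -> a P x = 0
    & exists C, forall P x, K x -> `|a P x| <= C * gauge P x ^+ m].

(* [b] is [scale * x_k d/dx_k] applied to [a]. *)
Definition scaled_derivative k a b := forall P x, unit_cube x ->
  is_derive x (delta_mx ord0 k) (a P) (b P x / (scale P * x ord0 k)).

(* [N] scaled derivatives are controlled, each gaining a factor [gauge]. *)
Fixpoint symbol N Z m a : Prop :=
  match N with
  | 0 => bounded_symbol Z m a
  | N'.+1 => bounded_symbol Z m a /\
      forall k, exists2 b, symbol N' Z m.+1 b & scaled_derivative k a b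
  end.

Lemma symbol_bounded N Z m a : symbol N Z m a -> bounded_symbol Z m a.
Proof. by case: N => [|N] // []. Qed.

Lemma symbolW N Z m a : symbol N.+1 Z m a -> symbol N Z m a.
Proof.
elim: N m a => [|N IH] m a [a0 da] //; split=> // k.
by have [b /IH bN ab] := da k; exists b.
Qed.

Lemma eq_symbol N Z m a b : (forall P x, a P x = b P x) ->
  symbol N Z m a -> symbol N Z m b.
Proof. by move=> ab; suff -> : a = b by []; apply/funext => P; apply/funext => x. Qed.

Lemma bounded_symbolD Z m a b : bounded_symbol Z m a -> bounded_symbol Z m b ->
  bounded_symbol Z m (fun P x => a P x + b P x).
Proof.
move=> [ac a0 [C aC]] [bc b0 [D bD]]; split=> [P x xu|P x xZ|].
- exact: (continuousD (ac P x xu) (bc P x xu)).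
- by rewrite a0// b0// addr0.
- exists (C + D) => P x Kx; rewrite mulrDl (le_trans (ler_normD _ _))//.
  by rewrite lerD ?aC ?bD.
Qed.

Lemma symbolD N Z m a b : symbol N Z m a -> symbol N Z m b ->
  symbol N Z m (fun P x => a P x + b P x).
Proof.
elim: N m a b => [|N IH] m a b; first exact: bounded_symbolD.
move=> [a0 da] [b0 db]; split=> [|k]; first exact: bounded_symbolD.
have [[a' a'N aa'] [b' b'N bb']] := (da k, db k).
exists (fun P x => a' P x + b' P x); first exact: IH.
by move=> P x xu; rewrite mulrDl; apply: is_deriveD; [exact: aa'|exact: bb'].
Qed.

Lemma bounded_symbolM Z m1 m2 a b : bounded_symbol Z m1 a -> bounded_symbol setT m2 b ->
  bounded_symbol Z (m1 + m2) (fun P x => a P x * b P x).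
Proof.
move=> [ac a0 [C aC]] [bc _ [D bD]]; split=> [P x xu|P x xZ|].
- exact: (continuousM (ac P x xu) (bc P x xu)).
- by rewrite a0// mul0r.
- exists (C * D) => P x Kx; rewrite exprD mulrACA normrM.
  by rewrite ler_pM ?aC ?bD.
Qed.

Lemma symbolM N Z m1 m2 a b : symbol N Z m1 a -> symbol N setT m2 b ->
  symbol N Z (m1 + m2) (fun P x => a P x * b P x).
Proof.
elim: N m1 m2 a b => [|N IH] m1 m2 a b; first exact: bounded_symbolM.
move=> aN bN; have [a0 da] := aN; have [b0 db] := bN.
split=> [|k]; first exact: bounded_symbolM.
have [[a' a'N aa'] [b' b'N bb']] := (da k, db k).
exists (fun P x => a' P x * b P x + a P x * b' P x).
  apply: symbolD; first by rewrite -addSn; exact: IH (symbolW bN).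
  by rewrite -addnS; exact: IH (symbolW aN) _.
move=> P x xu; apply: (is_derive_eq (is_deriveM (aa' P x xu) (bb' P x xu))).
by rewrite -![_ *: _]/(_ * _); ring.
Qed.

Lemma symbol0 N Z m : symbol N Z m (fun _ _ => 0).
Proof.
have zero0 i : bounded_symbol Z i (fun _ _ => 0).
  split=> // [P x _|]; first exact: cst_continuous.
  by exists 0 => P x _; rewrite normr0 mul0r.
elim: N m => // N IH m; split=> // k; exists (fun _ _ => 0); first exact: IH.
by move=> P x _; rewrite mul0r; exact: is_derive_cst.
Qed.

Lemma symbol_cst N m (c : params -> R) :
  (exists C, forall P x, K x -> `|c P| <= C * gauge P x ^+ m) ->
  symbol N setT m (fun P _ => c P).
Proof.
move=> cC; have c0 : bounded_symbol setT m (fun P _ => c P).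
  by split=> // [P x _|P x /(_ I)//]; exact: cst_continuous.
case: N => [//|N]; split=> // k; exists (fun _ _ => 0); first exact: symbol0.
by move=> P x _; rewrite mul0r; exact: is_derive_cst.
Qed.

Lemma symbol_cst_order0 N (c : params -> R) C : (forall P, `|c P| <= C) ->
  symbol N setT 0 (fun P _ => c P).
Proof. by move=> cC; apply: symbol_cst; exists C => P x _; rewrite expr0 mulr1. Qed.

Lemma symbol_scale N : symbol N setT 1 (fun P _ => scale P).
Proof. by apply: symbol_cst; exists 1 => P x _; rewrite mul1r expr1 scale_le_gauge. Qed.

Lemma symbol_sum N Z m I (s : seq I) (F : I -> params -> 'rV[R]_n -> R) :
  (forall i, symbol N Z m (F i)) -> symbol N Z m (fun P x => \sum_(i <- s) F i P x).
Proof.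
move=> FN; elim: s => [|i s IH].
  by apply: eq_symbol (symbol0 N Z m) => P x; rewrite big_nil.
by apply: eq_symbol (symbolD (FN i) IH) => P x; rewrite big_cons.
Qed.

Lemma scaled_derivativeI k a b (d : params -> 'rV[R]_n -> R) :
  (forall P x, unit_cube x -> is_derive x (delta_mx ord0 k) (a P) (d P x)) ->
  (forall P x, unit_cube x -> b P x = scale P * (x ord0 k * d P x)) ->
  scaled_derivative k a b.
Proof.
move=> ad bE P x xu; apply: (is_derive_eq (ad P x xu)); rewrite bE//.
by field; rewrite scale_neq0 unit_cube_neq0.
Qed.

Lemma meval_logderiv k (p : {mpoly R[n]}) x :
  (logderiv k p).@[x ord0] = x ord0 k * p^`M(k).@[x ord0].
Proof. by rewrite /logderiv mevalM mevalXU. Qed.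

Hypothesis K_compact : compact K.
Hypothesis K_unit_cube : K `<=` unit_cube.

Lemma closed_K : closed K.
Proof. by apply: compact_closed => //; exact: norm_hausdorff. Qed.

Lemma symbol_meval N (p : {mpoly R[n]}) : symbol N setT 0 (fun _ x => p.@[x ord0]).
Proof.
have p0 q : bounded_symbol setT 0 (fun _ x => q.@[x ord0]).
  split=> [_ x _|P x /(_ I)//|]; first exact: continuous_meval.
  have [|C qC] := compact_bounded_image (g := fun x => q.@[x ord0]) K_compact.
    by move=> x _; exact: continuous_meval.
  by exists C => P x Kx; rewrite expr0 mulr1; exact: qC.
elim: N p => [//|N IH] p; split=> // k.
exists (fun P x => scale P * (logderiv k p).@[x ord0]).
  exact: symbolM (symbol_scale N) (IH _).
apply: (scaled_derivativeI (d := fun _ x => p^`M(k).@[x ord0])) => P x _.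
  exact: is_derive_meval_delta.
by rewrite meval_logderiv.
Qed.

Lemma symbol_iter_partial N (varpi : 'rV[R]_n -> R) (s : seq 'I_n) :
  smooth varpi -> fsupport varpi `<=` K -> symbol N K 0 (fun _ => iter_partial s varpi).
Proof.
move=> varpi_smooth varpi_supp.
have varpi0 r : bounded_symbol K 0 (fun _ => iter_partial r varpi).
  split=> [_ x _|_|].
  - exact: continuous_iter_partial.
  - exact: iter_partial_out closed_K varpi_supp.
  - have [|C vC] := compact_bounded_image (g := iter_partial r varpi) K_compact.
      by move=> x _; exact: continuous_iter_partial.
    by exists C => P x Kx; rewrite expr0 mulr1; exact: vC.
elim: N s => [//|N IH] s; split=> // k.
exists (fun P x =>
    iter_partial (k :: s) varpi x * (scale P * ('X_k : {mpoly R[n]}).@[x ord0])).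
  apply: (symbolM (m2 := 1) (IH (k :: s))).
  exact: symbolM (symbol_scale N) (symbol_meval N 'X_k).
apply: (scaled_derivativeI (d := fun _ x => iter_partial (k :: s) varpi x)) => P x _.
  exact: is_derive_iter_partial.
by rewrite mevalXU; ring.
Qed.

Lemma log_form_bounded : exists C, forall P x, K x -> `|log_form (expo P) x| <= C.
Proof.
have /choice[C lnC] k : exists C, forall x, K x -> `|ln (x ord0 k)| <= C.
  by apply: compact_bounded_image => // x /K_unit_cube; exact: continuous_ln_coord.
exists (\sum_k B * C k) => P x Kx; apply: le_trans (ler_norm_sum _ _ _) _.
by apply: ler_sum => k _; rewrite normrM ler_pM ?expo_le ?lnC.
Qed.

Lemma symbol_expR_log_form N : symbol N setT 0 (fun P x => expR (log_form (expo P) x)).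
Proof.
have exp0 : bounded_symbol setT 0 (fun P x => expR (log_form (expo P) x)).
  split=> [P x xu|P x /(_ I)//|].
    apply: (@continuous_comp _ _ _ (log_form (expo P)) (@expR R)).
      exact: continuous_log_form.
    exact: continuous_expR.
  have [C lC] := log_form_bounded; exists (expR C) => P x Kx.
  by rewrite expr0 mulr1 ger0_norm ?expR_ge0// ler_expR (le_trans (ler_norm _))// lC.
elim: N => [//|N IH]; split=> // k.
exists (fun P x => expR (log_form (expo P) x) * (scale P * expo P k)).
  apply: (symbolM (m2 := 1) IH); apply: (symbolM (m2 := 0) (symbol_scale N)).
  by apply: (symbol_cst_order0 _ (C := B)) => P; exact: expo_le.
apply: (scaled_derivativeI
  (d := fun P x => expR (log_form (expo P) x) * (expo P k / x ord0 k))).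
  move=> P x xu.
  by apply: is_derive_comp (is_derive_log_form _ _ xu) (is_derive_expR _).
by move=> P x xu; field; exact: unit_cube_neq0.
Qed.

Definition rate P : R := scale P ^+ 2 * freq P.

Definition drift k P x : R :=
  \sum_l field l P x * (rate P * (logderiv k (logderiv l f)).@[x ord0]).

Lemma norm_rate_le1 P : `|rate P| <= 1.
Proof.
rewrite /rate sqr_scale normrM ger0_norm ?invr_ge0 ?addr_ge0//.
by rewrite ler_pdivrMl ?ltr_wpDr// mulr1 lerDr.
Qed.

Lemma meval_logderiv_slope k l P x :
  scale P * (logderiv k (slope l P)).@[x ord0] =
  rate P * (logderiv k (logderiv l f)).@[x ord0].
Proof.
rewrite !meval_logderiv /slope mderivZ mderivD mderivZ mderivC addr0 !mevalZ /rate.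
by ring.
Qed.

Lemma is_derive_localizer k P x : is_derive x (delta_mx ord0 k) (localizer P)
  (- localizer P x ^+ 2 * (energy P)^`M(k).@[x ord0]).
Proof.
apply: is_deriveV; first exact: energy1_neq0.
apply: (is_derive_eq (is_deriveD
  (is_derive_cst (1 : R) x (delta_mx ord0 k)) (is_derive_meval_delta (energy P) x k))).
by rewrite add0r.
Qed.

Lemma driftE k P x :
  scale P * (x ord0 k * (localizer P x * (energy P)^`M(k).@[x ord0])) = 2 * drift k P x.
Proof.
have -> : (energy P)^`M(k) = \sum_l 2 *: (slope l P * (slope l P)^`M(k)).
  rewrite /energy raddf_sum; apply: eq_bigr => l _ /=.
  by rewrite expr2 mderivM [_^`M(k) * _]mulrC -mulr2n scaler_nat.
rewrite raddf_sum !mulr_sumr; apply: eq_bigr => l _ /=.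
by rewrite -meval_logderiv_slope meval_logderiv mevalZ mevalM /field; ring.
Qed.

Lemma scaled_derivative_localizer k :
  scaled_derivative k localizer (fun P x => localizer P x * (-2 * drift k P x)).
Proof.
apply: (scaled_derivativeI
  (d := fun P x => - localizer P x ^+ 2 * (energy P)^`M(k).@[x ord0])).
  by move=> P x _; exact: is_derive_localizer.
by move=> P x _; rewrite mulNr -driftE; ring.
Qed.

Lemma scaled_derivative_field k l : scaled_derivative k (field l) (fun P x =>
  localizer P x * (rate P * (logderiv k (logderiv l f)).@[x ord0]) +
  field l P x * (-2 * drift k P x)).
Proof.
apply: (scaled_derivativeI (d := fun P x =>
  (slope l P).@[x ord0] * (- localizer P x ^+ 2 * (energy P)^`M(k).@[x ord0]) +
  localizer P x * (slope l P)^`M(k).@[x ord0])) => P x _.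
  exact: is_deriveM (is_derive_meval_delta _ _ _) (is_derive_localizer _ _ _).
by rewrite mulNr -driftE -meval_logderiv_slope meval_logderiv /field; ring.
Qed.

Lemma symbol_rate_meval N (p : {mpoly R[n]}) :
  symbol N setT 0 (fun P x => rate P * p.@[x ord0]).
Proof. exact: symbolM (symbol_cst_order0 _ norm_rate_le1) (symbol_meval _ _). Qed.

Lemma symbol_drift N k : (forall l, symbol N setT 1 (field l)) ->
  symbol N setT 1 (fun P x => -2 * drift k P x).
Proof.
move=> fieldN; apply: (symbolM (m1 := 0)).
  by apply: (symbol_cst_order0 _ (C := `|-2|)).
by apply: symbol_sum => l; apply: (symbolM (fieldN l)); exact: symbol_rate_meval.
Qed.

Lemma symbol_localizer_field N :
  symbol N setT 2 localizer /\ forall l, symbol N setT 1 (field l).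
Proof.
have loc_cont P x : {for x, continuous (localizer P)}.
  apply: continuousV; first exact: energy1_neq0.
  apply: (continuousD (@cst_continuous _ _ _ _)).
  exact: (continuous_meval (p := energy P)).
have loc0 : bounded_symbol setT 2 localizer.
  split=> [P x _|P x /(_ I)//|]; first exact: loc_cont.
  by exists 1 => P x _; rewrite mul1r localizer_le_gauge.
have field0 l : bounded_symbol setT 1 (field l).
  split=> [P x _|P x /(_ I)//|].
    exact: (continuousM (continuous_meval (x := x)) (loc_cont P x)).
  by exists 1 => P x _; rewrite mul1r field_le_gauge.
elim: N => [//|N [locN fieldN]]; split=> [|l]; split=> // k.
  eexists; last exact: scaled_derivative_localizer.
  exact: symbolM locN (symbol_drift _ fieldN).
eexists; last exact: scaled_derivative_field.
apply: symbolD; last exact: symbolM (fieldN l) (symbol_drift _ fieldN).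
exact: symbolM locN (symbol_rate_meval _ _).
Qed.

Lemma test_function_symbol m a P (w : 'rV[R]_n -> R) : bounded_symbol K m a ->
  (forall x, unit_cube x -> {for x, continuous w}) ->
  test_function (fun x => a P x * w x).
Proof.
move=> [ac a0 _] wc; split=> [x|x xu]; last by rewrite a0 ?mul0r// => /K_unit_cube.
have [/K_unit_cube xu|xK] := pselect (K x).
  exact: (continuousM (ac P x xu) (wc x xu)).
rewrite /continuous_at a0// mul0r; apply: cvg_near_cst; first exact: nbhs_filter.
apply: (@filterS _ _ (nbhs_filter x) _ _ _ (nbhs_closedC closed_K xK)) => y yK.
by rewrite a0// mul0r.
Qed.

Lemma continuous_phase P (th : R) x : unit_cube x ->
  {for x, continuous (fun y => phase P y + th)}.
Proof.
move=> xu; apply: (@continuousD _ _ _ (phase P) (fun=> th)); last exact: cst_continuous.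
apply: (@continuousD _ _ _ (fun y : 'rV[R]_n => freq P * f.@[y ord0])
  (log_form (twist P))).
  exact: (continuousM (@cst_continuous _ _ _ _) (continuous_meval (x := x))).
exact: continuous_log_form.
Qed.

Lemma is_derive_phase k P x : unit_cube x ->
  is_derive x (delta_mx ord0 k) (phase P)
    ((slope k P).@[x ord0] / (scale P * x ord0 k)).
Proof.
move=> xu; apply: (is_derive_eq (is_deriveD
  (is_deriveZ (freq P) (is_derive_meval_delta f x k))
  (is_derive_log_form (twist P) k xu))).
rewrite /slope mevalZ mevalD mevalZ mevalC meval_logderiv -[_ *: _]/(_ * _).
by field; rewrite scale_neq0 unit_cube_neq0.
Qed.

Definition oscillation P (th : R) a :=
  iter_integral (fun x => a P x * cos (phase P x + th)).

Lemma continuous_comp_phase P (th : R) (h : R -> R) x : continuous h -> unit_cube x ->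
  {for x, continuous (fun y => h (phase P y + th))}.
Proof.
move=> hc xu; apply: (@continuous_comp _ _ _ (fun y => phase P y + th) h) (hc _).
exact: continuous_phase.
Qed.

Lemma test_function_oscillation m a P (th : R) : bounded_symbol K m a ->
  test_function (fun x => a P x * cos (phase P x + th)).
Proof.
move=> a0; apply: (test_function_symbol _ a0) => x.
by apply: continuous_comp_phase; exact: continuous_cos.
Qed.

Lemma iter_integral_divergence m m' k P (th : R) a a' :
  bounded_symbol K m a -> bounded_symbol K m' a' -> scaled_derivative k a a' ->
  let div x := a' P x * sin (phase P x + th) + a P x *
    (scale P * sin (phase P x + th) + (slope k P).@[x ord0] * cos (phase P x + th)) in
  test_function div /\ iter_integral div = 0.
Proof.
move=> a0 a'0 aa' div.
have sin_phase x : unit_cube x -> {for x, continuous (fun y => sin (phase P y + th))}.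
  by apply: continuous_comp_phase; exact: continuous_sin.
have cos_phase x : unit_cube x -> {for x, continuous (fun y => cos (phase P y + th))}.
  by apply: continuous_comp_phase; exact: continuous_cos.
have test_div : test_function div.
  apply: test_functionD; first exact: test_function_symbol a'0 sin_phase.
  apply: test_function_symbol a0 _ => x xu.
  apply: (@continuousD _ _ _ (fun y => scale P * sin (phase P y + th))
    (fun y => (slope k P).@[y ord0] * cos (phase P y + th))).
    exact: (continuousM (@cst_continuous _ _ _ _) (sin_phase x xu)).
  exact: (continuousM (continuous_meval (x := x)) (cos_phase x xu)).
split=> //; pose F x := a P x * (scale P * x ord0 k * sin (phase P x + th)).
apply: (iter_integral_derive (k := k) (f := F)) => // [|x xu].
  apply: test_function_symbol a0 _ => x xu.
  apply: (@continuousM _ _ (fun y : 'rV[R]_n => scale P * y ord0 k)) (sin_phase x xu).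
  exact: (continuousM (@cst_continuous _ _ _ _) (@coord_continuous _ _ _ _ _ _)).
have dsin := is_derive_comp (is_deriveD (is_derive_phase k P xu)
  (is_derive_cst th x (delta_mx ord0 k))) (is_derive_sin _).
have dcoord := is_deriveZ (scale P) (is_derive_coord x (delta_mx ord0 k) k).
apply: (is_derive_eq (is_deriveM (aa' P x xu) (is_deriveM dcoord dsin))).
rewrite /div mxE !eqxx -[(phase P + cst th) x]/(phase P x + th).
rewrite -[X in _ + X *: (a' P x / _)]/(scale P * x ord0 k * sin (phase P x + th)).
by rewrite /= -![_ *: _]/(_ * _); field; rewrite scale_neq0 unit_cube_neq0.
Qed.

(* Integration by parts along [scale * sum_k field k * x_k d/dx_k], a vector
   field for which the derivative of the phase is [1 - localizer]. *)
Lemma oscillation_transport N m a : symbol N.+1 K m a ->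
  exists2 b, symbol N K m.+2 b & forall P th,
    oscillation P th a =
    oscillation P th (fun P x => a P x * localizer P x) - oscillation P (th - pi / 2) b.
Proof.
move=> aN; pose flux i P x := a P x * field i P x.
have fluxN i : symbol N.+1 K m.+1 (flux i).
  have [_ fieldN] := symbol_localizer_field N.+1.
  by have := symbolM aN (fieldN i); rewrite addn1.
have /choice[b' /all_and2[b'N fluxb']] : forall i : 'I_n, exists b',
    symbol N K m.+2 b' /\ scaled_derivative i (flux i) b'.
  by move=> i; have [_ /(_ i)[b' ? ?]] := fluxN i; exists b'.
pose term i P x := b' i P x + flux i P x * scale P.
have termN i : symbol N K m.+2 (term i).
  have := symbolM (symbolW (fluxN i)) (symbol_scale N); rewrite addn1.
  exact: symbolD.
pose b P x := \sum_i term i P x; have bN : symbol N K m.+2 b by exact: symbol_sum.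
exists b => // P th; pose div i x := b' i P x * sin (phase P x + th) + flux i P x *
  (scale P * sin (phase P x + th) + (slope i P).@[x ord0] * cos (phase P x + th)).
have /all_and2[test_div div0] i : test_function (div i) /\ iter_integral (div i) = 0.
  exact: iter_integral_divergence (symbol_bounded (fluxN i))
    (symbol_bounded (b'N i)) (fluxb' i).
have sum_div x : \sum_i div i x = b P x * cos (phase P x + (th - pi / 2)) +
    (a P x * cos (phase P x + th) +
     -1 * (a P x * localizer P x * cos (phase P x + th))).
  have -> : a P x * cos (phase P x + th) +
      -1 * (a P x * localizer P x * cos (phase P x + th)) =
      \sum_i a P x * (field i P x * (slope i P).@[x ord0]) * cos (phase P x + th).
    by rewrite -mulr_suml -mulr_sumr sum_field_slope; ring.
  rewrite (addrA (phase P x)) cosBpihalf mulr_suml -big_split; apply: eq_bigr => i _ /=.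
  by rewrite /div /term /flux; ring.
have := iter_integral_sum (index_enum 'I_n) test_div; rewrite [RHS]big1//.
under eq_fun do rewrite sum_div.
have test_b := test_function_oscillation P (th - pi / 2) (symbol_bounded bN).
have test_a := test_function_oscillation P th (symbol_bounded aN).
have test_loc := test_function_oscillation P th
  (bounded_symbolM (symbol_bounded aN) (symbol_bounded (symbol_localizer_field 0).1)).
rewrite iter_integralD ?iter_integralD ?iter_integralZ//; first last.
- exact: test_functionD (test_functionZ _ test_loc).
- exact: test_functionZ.
by rewrite /oscillation /= mulN1r; lra.
Qed.

Section TwoCoordinateDecay.
Variables (c : R) (j k : 'I_n).
Hypothesis c_gt0 : 0 < c.
Hypothesis k_neq_j : k != j.
Hypothesis log_gradient_lower_bound : forall x y, K x -> K y ->
  (forall l, l != j -> l != k -> x ord0 l = y ord0 l) ->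
  c * ((x ord0 j - y ord0 j) ^+ 2 + (x ord0 k - y ord0 k) ^+ 2) <=
  \sum_l ((logderiv l f).@[x ord0] - (logderiv l f).@[y ord0]) ^+ 2.

Definition decay_rate P : R := Num.sqrt c / 2 * (scale P * `|freq P|).

Lemma energy_lower_bound P x y : K x -> K y ->
  (forall l, l != j -> l != k -> x ord0 l = y ord0 l) ->
  (energy P).@[y ord0] <= (energy P).@[x ord0] ->
  (decay_rate P * (x ord0 j - y ord0 j)) ^+ 2 +
  (decay_rate P * (x ord0 k - y ord0 k)) ^+ 2 <= (energy P).@[x ord0].
Proof.
move=> Kx Ky xy yx; pose T := (scale P * freq P) ^+ 2.
have sum_slope : \sum_l ((slope l P).@[x ord0] - (slope l P).@[y ord0]) ^+ 2 =
    T * \sum_l ((logderiv l f).@[x ord0] - (logderiv l f).@[y ord0]) ^+ 2.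
  rewrite mulr_sumr; apply: eq_bigr => l _.
  by rewrite /slope !mevalZ !mevalD !mevalZ !mevalC /T; ring.
have slope_le : \sum_l ((slope l P).@[x ord0] - (slope l P).@[y ord0]) ^+ 2 <=
    4 * (energy P).@[x ord0].
  apply: (@le_trans _ _ (2 * (energy P).@[x ord0] + 2 * (energy P).@[y ord0]));
    last by lra.
  rewrite !energyE !mulr_sumr -big_split; apply: ler_sum => l _ /=.
  by have := sqr_ge0 ((slope l P).@[x ord0] + (slope l P).@[y ord0]); lra.
have := ler_wpM2l (sqr_ge0 (scale P * freq P)) (log_gradient_lower_bound Kx Ky xy).
rewrite -/T -sum_slope => /le_trans/(_ slope_le).
have decay2 : decay_rate P ^+ 2 = c * T / 4.
  rewrite /decay_rate /T !exprMn real_normK ?num_real// sqr_sqrtr ?(ltW c_gt0)//.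
  by rewrite exprVn; field.
by rewrite !(exprMn 2 (decay_rate P)) decay2; lra.
Qed.

Lemma localizer_slice_decay P x : exists u v : R, forall a b : R,
  K (set_coord (set_coord x j a) k b) ->
  localizer P (set_coord (set_coord x j a) k b) ^+ 2 <=
  lorentzian (decay_rate P * (a - u)) * lorentzian (decay_rate P * (b - v)).
Proof.
pose S := K `&` \bigcap_(l in [set l | l != j /\ l != k])
  ((fun y : 'rV[R]_n => y ord0 l) @^-1` [set z | z = x ord0 l]).
have S_compact : compact S.
  apply: compact_closedI => //; apply: closed_bigI => l _.
  by apply: preimage_closed; [move=> y _; exact: coord_continuous|exact: closed_eq].
pose slice (a b : R) := set_coord (set_coord x j a) k b.
have S_slice (a b : R) : K (slice a b) -> S (slice a b).
  by move=> Kab; split=> // l [lj lk] /=; rewrite !mxE (negbTE lk) (negbTE lj).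
have [[y0 Sy0]|S0] := pselect (S !=set0); last first.
  by exists 0, 0 => a b /S_slice Sab; case: S0; exists (slice a b).
have [|y /set_mem[Ky yx] y_min] := EVT_min_rV (ex_intro _ y0 Sy0) S_compact
    (f := fun z => (energy P).@[z ord0]).
  by apply: continuous_subspaceT; exact: continuous_meval.
exists (y ord0 j), (y ord0 k) => a b Kab; set z := set_coord _ k b in Kab *.
have /(energy_lower_bound Kab Ky) : forall l, l != j -> l != k -> z ord0 l = y ord0 l.
  by move=> l lj lk; rewrite (yx l (conj lj lk)) !mxE (negbTE lk) (negbTE lj).
move=> /(_ P (y_min z (mem_set (S_slice _ _ Kab)))).
have -> : z ord0 j = a by rewrite !mxE eq_sym (negbTE k_neq_j) eqxx.
rewrite set_coordE => energy_ge.
have bound (w : R) : w ^+ 2 <= (energy P).@[z ord0] -> localizer P z <= lorentzian w.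
  by move=> we; rewrite lef_pV2 ?posrE ?energy1_gt0 ?ltr_pwDl ?sqr_ge0// lerD2l.
rewrite expr2 ler_pM ?localizer_ge0//; apply/bound/le_trans/energy_ge.
  by rewrite lerDl sqr_ge0.
by rewrite lerDr sqr_ge0.
Qed.

Lemma riemann_sum_sqr_localizer_le P N : 0 < decay_rate P <= N.+1%:R ->
  riemann_sum N (fun x => localizer P x ^+ 2 * \1_K x) <= (3 * pi / decay_rate P) ^+ 2.
Proof.
move=> rN; rewrite -(riemann_sum_coord_mean N k) -(riemann_sum_coord_mean N j).
rewrite -[leRHS](riemann_sum_cst N n); apply: ler_riemann_sum => x _.
have [u [v decay]] := localizer_slice_decay P x.
apply: (midpoint_mean2_lorentzian_le (c := u) (d := v)) => // a b; rewrite indicE.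
case: (boolP (_ \in K)) => [/set_mem/decay|_]; first by rewrite mulr1.
by rewrite mulr0 mulr_ge0 ?lorentzian_ge0.
Qed.

Lemma decay_rate_lower_bound P : 1 <= `|freq P| ->
  c / 16 <= (decay_rate P * scale P) ^+ 2.
Proof.
move=> t1; set t := `|freq P| in t1 *.
have half_le : 2^-1 <= scale P ^+ 2 * t.
  by rewrite sqr_scale -/t mulrC ler_pdivlMr ?ltr_wpDl//; lra.
have -> : (decay_rate P * scale P) ^+ 2 = c / 4 * (scale P ^+ 2 * t) ^+ 2.
  by rewrite -[in RHS](sqr_sqrtr (ltW c_gt0)) /decay_rate -/t; field.
have -> : c / 16 = c / 4 * 2^-1 ^+ 2 by field.
have st0 : 0 <= scale P ^+ 2 * t by rewrite mulr_ge0 ?sqr_ge0// (le_trans _ t1).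
by rewrite ler_pM2l ?divr_gt0// ler_pXn2r// nnegrE invr_ge0.
Qed.

Lemma near_riemann_sum_sqr_localizer_le : exists C, forall P,
  \forall N \near \oo,
    riemann_sum N (fun x => localizer P x ^+ 2 * \1_K x) <= C * scale P ^+ 2.
Proof.
pose C := 16 * (3 * pi) ^+ 2 / c.
have C0 : 0 <= C by apply: divr_ge0 (ltW c_gt0); exact: mulr_ge0 (sqr_ge0 _).
exists (2 + C) => P; have s0 : 0 < scale P ^+ 2 by rewrite exprn_gt0// scale_gt0.
rewrite mulrDl; have [t1|/ltW t1] := leP `|freq P| 1.
  apply: nearW => N; apply: (@le_trans _ _ (2 * scale P ^+ 2)).
    rewrite -[leLHS]mulr1 -[leRHS](riemann_sum_cst N n) mulr1.
    apply: ler_riemann_sum => x _.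
    apply: (@le_trans _ _ 1); last by rewrite sqr_scale ler_pdivlMr ?ltr_wpDr//; lra.
    rewrite indicE mulr_ile1 ?sqr_ge0 ?exprn_ile1 ?localizer_ge0 ?localizer_le1//.
    by case: (_ \in _).
  by rewrite lerDl mulr_ge0// ltW.
have rate_gt0 : 0 < decay_rate P.
  by rewrite mulr_gt0 ?divr_gt0 ?sqrtr_gt0// mulr_gt0 ?scale_gt0// (lt_le_trans _ t1).
have rate_inv_gt0 : 0 < (decay_rate P)^-1 by rewrite invr_gt0.
apply: filterS (near_invS_le rate_inv_gt0) => N; rewrite lef_pV2 ?posrE ?ltr0Sn// => rN.
apply: (@le_trans _ _ (C * scale P ^+ 2)); last by rewrite lerDr mulr_ge0// ltW.
apply: le_trans (riemann_sum_sqr_localizer_le _) _; first by rewrite rate_gt0.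
have := decay_rate_lower_bound t1; rewrite ler_pdivrMr// => lower.
rewrite expr_div_n ler_pdivrMr ?exprn_gt0// /C mulrAC -mulrA mulrAC ler_pdivlMr//.
rewrite [_ ^+ 2 * c]mulrC; apply: le_trans (ler_wpM2r (sqr_ge0 _) lower) _.
by rewrite exprMn; lra.
Qed.

Lemma gauge_expr4_le P x : gauge P x ^+ 4 <= 2 * (localizer P x ^+ 2 + scale P ^+ 2).
Proof.
have -> : gauge P x ^+ 4 = (gauge P x ^+ 2) ^+ 2 by rewrite -exprM.
rewrite sqr_gauge; set l := localizer P x.
have s2_le1 : scale P ^+ 2 <= 1 by rewrite sqr_scale invf_le1 ?ltr_wpDr// lerDl.
have s4_le : (scale P ^+ 2) ^+ 2 <= scale P ^+ 2.
  by rewrite expr2 ler_piMr ?sqr_ge0.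
by have := sqr_ge0 (l - scale P ^+ 2); lra.
Qed.

Lemma oscillation_bound_order4 a : bounded_symbol K 4 a ->
  exists C, forall P th, `|oscillation P th a| <= C * scale P ^+ 2.
Proof.
move=> a0; have [_ a_out [C aC]] := a0.
have [D locD] := near_riemann_sum_sqr_localizer_le.
exists (2 * `|C| * (D + 1)) => P th.
apply: ler_norm_iter_integral; first exact: test_function_oscillation a0.
have pointwise x : `|a P x * cos (phase P x + th)| <=
    2 * `|C| * (localizer P x ^+ 2 * \1_K x + scale P ^+ 2).
  rewrite normrM; apply: (@le_trans _ _ `|a P x|).
    by rewrite ler_piMr// ler_norml cos_geN1 cos_le1.
  have [Kx|xK] := pselect (K x); last first.
    by rewrite a_out// normr0 !mulr_ge0// addr_ge0 ?sqr_ge0// mulr_ge0 ?sqr_ge0.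
  rewrite indicE mem_set// mulr1; apply: le_trans (aC P x Kx) _.
  apply: le_trans (ler_wpM2r (exprn_ge0 4 (gauge_ge0 P x)) (ler_norm C)) _.
  by rewrite [2 * _]mulrC -mulrA ler_wpM2l// gauge_expr4_le.
apply: filterS (locD P) => N locN.
apply: le_trans (ler_riemann_sum N (fun x _ => pointwise x)) _.
rewrite riemann_sumZ riemann_sumD riemann_sum_cst -[leRHS]mulrA ler_wpM2l ?mulr_ge0//.
by rewrite mulrDl mul1r lerD2r.
Qed.

Lemma oscillation_bound N m a : (m + N.*2 = 4)%N -> symbol N K m a ->
  exists C, forall P th, `|oscillation P th a| <= C * scale P ^+ 2.
Proof.
elim: N m a => [|N IH] m a.
  by rewrite addn0 => ->; exact: oscillation_bound_order4.
rewrite doubleS -!addSnnS => mN aN; have [b bN transport] := oscillation_transport aN.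
have locN := symbolM (symbolW aN) (symbol_localizer_field N).1.
rewrite addn2 in locN; have [C aC] := IH _ _ mN locN; have [D bD] := IH _ _ mN bN.
exists (C + D) => P th; rewrite transport [leRHS]mulrDl.
exact: le_trans (ler_normB _ _) (lerD (aC _ _) (bD _ _)).
Qed.

Lemma power_weight_oscillation_bound (varpi : 'rV[R]_n -> R) :
  smooth varpi -> fsupport varpi `<=` K ->
  exists2 C, 0 < C & forall P (th : R),
    `|iter_integral (fun x => varpi x * expR (log_form (expo P) x) *
        cos (phase P x + th))| <= C / (1 + `|freq P|).
Proof.
move=> varpi_smooth varpi_supp.
have weightN := symbolM (symbol_iter_partial 2 [::] varpi_smooth varpi_supp)
  (symbol_expR_log_form 2).
have [C bound] := oscillation_bound (m := 0) (N := 2) erefl weightN.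
exists (`|C| + 1) => [|P th]; first by rewrite ltr_wpDl.
rewrite -sqr_scale; apply: le_trans (bound P th) (ler_wpM2r (sqr_ge0 _) _).
by rewrite (le_trans (ler_norm C))// lerDl.
Qed.

End TwoCoordinateDecay.

End Symbols.

(** * The complex oscillatory integral *)

Section ComplexExponential.
Context {R : realType}.

Lemma cexpD (z w : R[i]) : cexp (z + w) = cexp z * cexp w.
Proof.
case: z w => [a b] [c e]; rewrite /cexp /= expRD cosD sinD.
by apply/eqP; rewrite eq_complex /=; apply/andP; split; apply/eqP; ring.
Qed.

Lemma cexp0 : cexp (0 : R[i]) = 1.
Proof. by rewrite /cexp /= expR0 cos0 sin0 mul1r. Qed.

Lemma prod_cpow n (x : 'rV[R]_n) (r t : 'I_n -> R) :
  \prod_(k < n) cpow (x ord0 k) (r k +i* t k) = cexp (log_form r x +i* log_form t x).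
Proof.
rewrite /log_form; elim/big_rec3: _ => [|k y b a _ ->]; first by rewrite -cexp0.
rewrite /cpow -cexpD; congr cexp.
by apply/eqP; rewrite eq_complex /=; apply/andP; split; apply/eqP; ring.
Qed.

Lemma oscillatory_integrandE n B (F : {mpoly R[n]}) varpi (P : @params R n B) x :
  let A := varpi x * expR (log_form (expo P) x) in
  oscillatory_integrand F varpi (freq P) (expo P) (twist P) x =
  (A * cos (phase ((2 * pi) *: F) P x)) +i* (A * sin (phase ((2 * pi) *: F) P x)).
Proof.
rewrite /oscillatory_integrand prod_cpow -mulrA -cexpD /cexp /phase mevalZ.
apply/eqP; rewrite eq_complex /=.
rewrite !(mulr0, mul0r, mulr1, subr0, addr0, add0r).
by rewrite [freq P * _ + _]addrC [freq P * _]mulrCA !mulrA !eqxx.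
Qed.

Lemma normc_le_add (a b : R) : `|a +i* b| <= (`|a| + `|b|)%:C.
Proof.
rewrite normc_def /= lecR -[leRHS]ger0_norm ?addr_ge0// -sqrtr_sqr ler_wsqrtr//.
rewrite sqrrD !real_normK ?num_real// -addrA lerD2l lerDr.
by rewrite mulrn_wge0// mulr_ge0.
Qed.

Lemma norm_iter_cintegral_le n B (F : {mpoly R[n]}) varpi (P : @params R n B) (M : R) :
  (forall th : R, `|iter_integral (fun x => varpi x * expR (log_form (expo P) x) *
     cos (phase ((2 * pi) *: F) P x + th))| <= M) ->
  `|iter_cintegral (oscillatory_integrand F varpi (freq P) (expo P) (twist P))|
    <= (2 * M)%:C.
Proof.
move=> IM; apply: le_trans (normc_le_add _ _) _; rewrite lecR mulr_natl mulr2n lerD//.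
  have := IM 0; congr (`| _ | <= _); congr iter_integral.
  by apply/funext => x; rewrite oscillatory_integrandE addr0.
have := IM (- (pi / 2)); congr (`| _ | <= _); congr iter_integral.
by apply/funext => x; rewrite oscillatory_integrandE cosBpihalf.
Qed.

Lemma inv1D_norm_le_min1inv (tau : R) : (1 + `|tau|)^-1 <= min1inv tau.
Proof.
rewrite /min1inv; case: eqVneq => [->|tau0]; first by rewrite normr0 addr0 invr1.
have tau_gt0 : 0 < `|tau| by rewrite normr_gt0.
have tau1_gt0 : 0 < 1 + `|tau| by rewrite ltr_wpDr.
by rewrite le_min invf_le1// lerDl normr_ge0 lef_pV2 ?posrE// lerDr ler01.
Qed.

End ComplexExponential.

Lemma nbhs_unit_cube (R : realType) n (x : 'rV[R]_n) : unit_cube x -> nbhs x unit_cube.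
Proof.
move=> xu; apply: (@filter_forall _ _ _ _ (nbhs_filter x)) => k.
have : \forall z \near x ord0 k, z \in `]0, 1[.
  by apply: near_in_itvoo; rewrite in_itv /= xu.
by move/coord_continuous; apply: (@filterS _ _ (nbhs_filter x)) => y; rewrite /= in_itv.
Qed.

Lemma box_norm_bounded (R : realType) (I : finType) (a b : I -> R) :
  exists B, forall r : I -> R, (forall i, a i <= r i <= b i) -> forall i, `|r i| <= B.
Proof.
exists (\sum_i (`|a i| + `|b i|)) => r rab i.
apply: (@le_trans _ _ (`|a i| + `|b i|)); last first.
  by rewrite (bigD1 i)//= lerDl sumr_ge0// => l _; rewrite addr_ge0.
have /andP[ar rb] := rab i; rewrite ler_norml.
have := ler_norm (b i); have := ler_norm (- a i); rewrite normrN.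
have := normr_ge0 (a i); have := normr_ge0 (b i).
by move=> *; apply/andP; split; lra.
Qed.

Theorem theorem1p1 (R : realType) (n d : nat) (F : {mpoly R[n]})
    (hd : (1 < d)%N)
    (hF : F \is d.-homog)
    (hdim : (4%:E < (n%:R)%:E - affine_dim (singular_locus F))%E)
    (theta theta' : 'I_n -> R)
    (htheta : forall j, theta j <= theta' j)
    (x0 : 'rV[R]_n)
    (hx0 : forall j, 0 < x0 ord0 j < 1)
    (hFx0 : F.@[x0 ord0] = 0)
    (hns : exists j, F^`M(j).@[x0 ord0] != 0) :
  exists2 delta1 : R, 0 < delta1 &
    forall delta0 : R, 0 < delta0 <= delta1 ->
    forall varpi : 'rV[R]_n -> R,
      smooth varpi -> fsupport varpi `<=` cube x0 delta0 ->
    exists2 C : R, 0 < C &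
      forall (tau : R) (r t : 'I_n -> R),
        (forall j, theta j <= r j <= theta' j) ->
        `|iter_cintegral (oscillatory_integrand F varpi tau r t)|
          <= (C * min1inv tau)%:C.
Proof.
pose f : {mpoly R[n]} := (2 * pi) *: F.
have pi2_neq0 : 2 * pi != 0 :> R by rewrite mulf_neq0// gt_eqF// pi_gt0.
have [||||j [k [c [h [kj c0 h0 lower]]]]] :=
    @dhomog_log_gradient_lower_bound _ _ d f x0 (ltnW hd).
- exact: dhomogZ.
- by move=> l; exact: unit_cube_neq0.
- by rewrite mevalZ hFx0 mulr0.
- by have [j Fj] := hns; exists j; rewrite mderivZ mevalZ mulf_neq0.
have [e e0 x0e] := nbhs_cube (nbhs_unit_cube hx0).
exists (Num.min h e); first by rewrite lt_min h0.
move=> delta0 /andP[_]; rewrite le_min => /andP[dh de] varpi varpi_smooth varpi_supp.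
have [B rB] := box_norm_bounded theta theta'.
have Ku : cube x0 delta0 `<=` unit_cube by move=> y /(cubeS de)/x0e.
have lowerK x y Kx Ky := lower x y (cubeS dh Kx) (cubeS dh Ky).
have [C C0 bound] := power_weight_oscillation_bound B (@compact_cube _ _ x0 delta0)
  Ku c0 kj lowerK varpi_smooth varpi_supp.
exists (2 * C); first by rewrite mulr_gt0.
move=> tau r t /rB r_le.
apply: le_trans (norm_iter_cintegral_le (bound (Params tau t r_le))) _.
by rewrite lecR -mulrA !ler_pM2l// inv1D_norm_le_min1inv.
Qed.
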